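(* Let $m\ge 1$, let $H,H_1,\dots,H_m$ be (real) Hilbert spaces of finite, positive dimensions, for each $1\le j\le m$ let $\ell_j:H\to H_j$ be a surjective linear transformation, and let $p_j\in[1,\infty]$. There exists $C<\infty$ such that $$\int_{\{y\in H:\,|y|\le 1\}}\prod_{j=1}^m f_j(\ell_j(y))\,dy\le C\prod_{j=1}^m\|f_j\|_{L^{p_j}(H_j)}$$ for all nonnegative measurable functions $f_j:H_j\to[0,\infty)$, if and only if for every linear subspace $V$ of $H$, $$\operatorname{codim}_H(V)\ge\sum_{j=1}^m p_j^{-1}\operatorname{codim}_{H_j}(\ell_j(V)).$$
   Context: Each finite-dimensional Hilbert space is equipped with its canonical Lebesgue measure, obtained by choosing an orthonormal basis and identifying the space with $\mathbb{R}^{d}$, $d$ its dimension. $\operatorname{codim}_W(V)=\dim(W)-\dim(V)$ denotes the codimension of a subspace $V\subset W$ in $W$. The convention $\infty^{-1}=0$ is used. *)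

(* Defs.v *)
From HB Require Import structures.
From mathcomp Require Import all_boot all_order all_algebra.
From mathcomp Require Import all_classical all_reals all_analysis.

Set Implicit Arguments.
Unset Strict Implicit.
Unset Printing Implicit Defensive.

Import Order.TTheory GRing.Theory Num.Theory.

Local Open Scope classical_set_scope.
Local Open Scope ring_scope.

Section LebesgueTuple.
Context {R : realType}.
Local Notation "'R^' n" := (n.-tuple (measurableTypeR R))
  (at level 2, n at level 2, format "'R^' n").

Definition cons_pair n (x : measurableTypeR R * R^n) : R^n.+1 :=
  [tuple of x.1 :: x.2].

Lemma measurable_cons_pair n : measurable_fun [set: _] (@cons_pair n).
Proof. exact: measurable_cons measurable_fst measurable_snd. Qed.

Section LebesgueCons.
Variables (n : nat) (mu : {sigma_finite_measure set R^n -> \bar R}).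

Definition lebesgue_cons : set R^n.+1 -> \bar R :=
  pushforward (@lebesgue_measure R \x mu)%E (@cons_pair n).

HB.instance Definition _ := Measure.copy lebesgue_cons
  (measure_function_pushforward__canonical__measure_function_Measure
     (@lebesgue_measure R \x mu)%E (@measurable_cons_pair n)).

Let lebesgue_cons_sigma_finite : sigma_finite setT lebesgue_cons.
Proof.
have /sigma_finiteP[F [TF ndF Foo]] := sigma_finiteT (@lebesgue_measure R).
have /sigma_finiteP[G [TG ndG Goo]] := sigma_finiteT mu.
pose g (t : R^n.+1) : measurableTypeR R * R^n := (thead t, [tuple of behead t]).
have mg : measurable_fun [set: R^n.+1] g.
  apply: measurable_fun_pair; first exact: measurable_tnth.
  exact: measurable_behead.
have gK : cancel (@cons_pair n) g by move=> [a t]; congr pair; exact/val_inj.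
exists (fun k => g @^-1` (F k `*` G k)) => [|k].
  rewrite -preimage_bigcup (_ : \bigcup_k _ = setT) ?preimage_setT//.
  apply/seteqP; split=> // -[x y] _.
  have [i _ Fix] : (\bigcup_i F i) x by rewrite -TF.
  have [j _ Gjy] : (\bigcup_i G i) y by rewrite -TG.
  exists (maxn i j) => //; split.
    by move: x Fix; exact/subsetPset/ndF/leq_maxl.
  by move: y Gjy; exact/subsetPset/ndG/leq_maxr.
have [mF Fkoo] := Foo k; have [mG Gkoo] := Goo k; split.
  by rewrite -[X in measurable X]setTI; apply: mg => //; exact: measurableX.
rewrite /lebesgue_cons /pushforward -comp_preimage (_ : g \o _ = id); last first.
  by apply/funext => x; exact: gK.
by rewrite preimage_id product_measure1E// lte_mul_pinfty// ge0_fin_numE.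
Qed.

HB.instance Definition _ :=
  Measure_isSigmaFinite.Build _ _ _ lebesgue_cons lebesgue_cons_sigma_finite.

End LebesgueCons.

Fixpoint lebesgue_tuple n : {sigma_finite_measure set R^n -> \bar R} :=
  match n with
  | 0 => \d_[tuple]
  | n'.+1 => lebesgue_cons (lebesgue_tuple n')
  end.

End LebesgueTuple.

(* A finite-dimensional real Hilbert space is a vectType R with a positive
   definite symmetric form {dot H for idfun}; completeness is automatic. *)
Section Hilbert.
Context {R : realType} {H : vectType R}.

Definition hnorm (dot : {dot H for idfun}) (x : H) : R := Num.sqrt (dot x x).

Variable e : (\dim {:H}).-tuple H.
Local Notation Rd := ((\dim {:H}).-tuple (measurableTypeR R)).

Definition lincomb (x : Rd) : H := \sum_(i < \dim {:H}) tnth x i *: tnth e i.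

(* H with the sigma-algebra transported from R^d by lincomb. When e is a basis,
   lincomb is a linear isomorphism and this is the Borel sigma-algebra of H
   (hence independent of e). *)
Definition borel of (\dim {:H}).-tuple H : Type := H.

HB.instance Definition _ := Choice.on (borel e).
HB.instance Definition _ := isPointed.Build (borel e) (0 : H).

Definition borel_measurable : set (set (borel e)) :=
  image_set_system setT lincomb measurable.

Let borel_measurable_sigma_algebra : sigma_algebra setT borel_measurable.
Proof. exact: sigma_algebra_image (sigma_algebra_measurable _). Qed.

Let borel_measurable0 : borel_measurable set0.
Proof. by case: borel_measurable_sigma_algebra. Qed.

Let borel_measurableC A : borel_measurable A -> borel_measurable (~` A).
Proof. by case: borel_measurable_sigma_algebra => _ + _ mA => /(_ _ mA); rewrite setTD. Qed.

Let borel_measurable_bigcup (F : (set (borel e))^nat) :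
  (forall i, borel_measurable (F i)) -> borel_measurable (\bigcup_i F i).
Proof. by case: borel_measurable_sigma_algebra => _ _; exact. Qed.

HB.instance Definition _ := @isMeasurable.Build default_measure_display (borel e)
  borel_measurable borel_measurable0 borel_measurableC borel_measurable_bigcup.

Definition lincomb_borel : Rd -> borel e := lincomb.

Lemma measurable_lincomb : measurable_fun [set: Rd] lincomb_borel.
Proof. by move=> _ A mA; exact: mA. Qed.

(* The canonical Lebesgue measure of H, when e is an orthonormal basis. *)
Definition lebesgue_borel : set (borel e) -> \bar R :=
  pushforward (@lebesgue_tuple R (\dim {:H})) lincomb_borel.

HB.instance Definition _ := Measure.copy lebesgue_borel
  (measure_function_pushforward__canonical__measure_function_Measure
     (@lebesgue_tuple R (\dim {:H})) measurable_lincomb).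

End Hilbert.

Arguments borel {R H} e.
Arguments lincomb {R H} e x.
Arguments lebesgue_borel {R H} e A.

Definition codim {R : realType} {W : vectType R} (V : {vspace W}) : nat :=
  (\dim {:W} - \dim V)%N.

(* Main.v *)
(* Write s_j = 1/p_j, call s feasible if it satisfies the codimension conditions
   and call V critical for s if equality holds at V.

   Sufficiency is an induction on the dimension of H.  If some V other than 0
   and H is critical, Fubini splits the integral over V and a complement of V:
   the inner data V -> l_j(V) and the outer data H/V -> H_j/l_j(V) are again
   feasible, with the same exponents.  Otherwise s can be moved in both
   directions along a line until an exponent vanishes or a new subspace becomes
   critical, and the bound at s follows by Hoelder from the bounds at the two
   ends.  When s cannot be moved, at most one exponent matters: either there is
   nothing to prove, or it is equal to 1 and the corresponding l_j is bijective.

   Necessity: test the inequality on the indicators of x-neighbourhoods of the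
   subspaces l_j(V), whose measures are of order x^(codim l_j(V)), against an
   x-neighbourhood of V inside the unit ball, and let x tend to 0.

   All the facts about changes of variables come from the uniqueness, up to a
   constant, of sigma-finite translation-invariant measures. *)
Require Import Defs.
From HB Require Import structures.
From mathcomp Require Import all_boot all_order all_algebra.
From mathcomp Require Import all_classical all_reals all_analysis.
From mathcomp Require Import measurable_realfun ess_sup_inf.
From mathcomp Require Import ring lra.

Set Implicit Arguments.
Unset Strict Implicit.
Unset Printing Implicit Defensive.

Import Order.TTheory GRing.Theory Num.Theory.

Local Open Scope classical_set_scope.
Local Open Scope ring_scope.

(** * Lebesgue measure on tuples *)

Section LebesgueTupleTheory.
Context {R : realType}.
Local Notation "'R^' n" := (n.-tuple (measurableTypeR R))
  (at level 2, n at level 2, format "'R^' n").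
Local Notation leb1 := (@lebesgue_measure R).

(** The induction leaves the setting of the theorem at once: it runs over subspaces and complements
    without a chosen inner product, and some targets shrink to 0. Hence [BL] is stated in arbitrary
    bases, over coordinate boxes of every size, and up to constants; orthonormality returns only
    when the unit ball is compared with boxes. Replacing each function by its power of exponent
    [p j] makes the data independent of the exponents, so that Hoelder's inequality alone
    interpolates between two values of s. Why s can be moved: the exponents that matter belong to
    surjective maps, so the constraint at V = H stays an equality under any move among them. If no
    other subspace than 0 and H is critical, the sole equation to preserve is the one at V = 0: the
    numbers s_j dim(H_j) sum to dim(H). One equation leaves a free direction once two exponents
    matter; if 0 is not critical, one exponent is enough. There are infinitely many subspaces but
    finitely many tuples of codimensions, so the first new equality is met after a positive time. *)

Lemma preimage_addr_ocitv (a x y : R) :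
  (fun z => z + a) @^-1` `]x, y] = `]x - a, y - a]%classic.
Proof. by apply/seteqP; split=> z /=; rewrite !in_itv/= ltrBlDr lerBrDr. Qed.

Lemma measurable_addrr (a : R) : measurable_fun [set: measurableTypeR R]
  ((fun z => z + a) : _ -> measurableTypeR R).
Proof. exact: measurable_funD. Qed.

(** The pushforward by a translation has the right values on half-open intervals, and these
    determine Lebesgue measure. *)
Lemma lebesgue_measure_translate (a : R) (A : set (measurableTypeR R)) :
  measurable A -> leb1 ((fun z => z + a) @^-1` A) = leb1 A.
Proof.
pose nu : {measure set (measurableTypeR R) -> \bar R} := 
  measure_function_pushforward__canonical__measure_function_Measure leb1
    (measurable_addrr a).
move=> mA; symmetry; apply: (lebesgue_measure_unique (mu := nu)) => //= _ [[x y]] _ <-.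
rewrite /nu /= /pushforward preimage_addr_ocitv !lebesgue_measure_itv/=.
rewrite !lte_fin ltrD2r -!EFinB; case: ifPn => // _.
by congr EFin; lra.
Qed.

Definition addt {n} (x v : R^n) : R^n := [tuple tnth x i + tnth v i | i < n].

Lemma measurable_addt n (v : R^n) : measurable_fun [set: R^n] (addt ^~ v).
Proof.
apply/measurable_fun_tnthP => i.
rewrite (_ : _ \o _ = (fun x : R^n => tnth x i + tnth v i)); last first.
  by apply/funext => x /=; rewrite tnth_mktuple.
by apply: measurable_funD => //; exact: measurable_tnth.
Qed.

Lemma addt_cons n (x : R * R^n) (v : R^n.+1) :
  addt (cons_pair x) v =
  cons_pair (x.1 + thead v, addt x.2 [tuple of behead v]).
Proof.
apply: eq_from_tnth => i; rewrite tnth_mktuple.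
have [->|[j ->]] : i = ord0 \/ exists j, i = lift ord0 j.
- by case: (unliftP ord0 i) => [j ->|->]; [right; exists j|left].
- by [].
- by rewrite !tnthS tnth_mktuple tnth_behead; congr (_ + tnth v _); apply/val_inj;
  rewrite /= inordK// ltnS.
Qed.

(** By induction on [n]: the translated product measure agrees with the product measure on
    rectangles, and a product measure is determined there. *)
Lemma lebesgue_tuple_translate n (v : R^n) (A : set R^n) : measurable A ->
  lebesgue_tuple n (addt ^~ v @^-1` A) = lebesgue_tuple n A.
Proof.
elim: n v A => [|n IHn] v A mA.
  suff -> : addt^~ v @^-1` A = A by [].
  by apply/seteqP; split=> x /=; rewrite (tuple0 (addt x v)) (tuple0 x).
rewrite /= /lebesgue_cons /pushforward -/(lebesgue_tuple n).
set v' := [tuple of behead v].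
pose g (x : measurableTypeR R * R^n) : measurableTypeR R * R^n :=
  (x.1 + thead v, addt x.2 v').
have mg : measurable_fun setT g.
  apply: measurable_fun_pair.
    by apply: measurable_funD => //; exact: measurable_fst.
  by apply: measurableT_comp (measurable_addt v') _; exact: measurable_snd.
pose mu := (leb1 \x lebesgue_tuple n)%E.
pose nu : {measure set (measurableTypeR R * R^n) -> \bar R} := 
  measure_function_pushforward__canonical__measure_function_Measure mu mg.
have mcA : measurable (@cons_pair R n @^-1` A).
  by rewrite -[X in measurable X]setTI; exact: measurable_cons_pair.
rewrite [RHS](@product_measure_unique _ _ _ _ _ leb1 (lebesgue_tuple n) nu)//.
  congr (_ _); apply/seteqP; split=> x; rewrite /preimage /= addt_cons//.
move=> B C mB mC; rewrite /nu /= /pushforward.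
rewrite (_ : g @^-1` _ =
  ((fun z => z + thead v) @^-1` B) `*` (addt ^~ v' @^-1` C)); last first.
  by apply/seteqP; split=> x.
rewrite /mu product_measure1E.
- by congr (_ * _)%E; [exact: lebesgue_measure_translate|exact: IHn].
- rewrite -[X in measurable X]setTI; exact: measurable_addrr.
- by rewrite -[X in measurable X]setTI; exact: measurable_addt.
Qed.

Definition tbox n (r : R) : set R^n := [set x | forall i, `|tnth x i| <= r].
Arguments tbox n r _ : clear implicits.

Lemma tbox_cons n r :
  @cons_pair R n @^-1` tbox n.+1 r = `[- r, r]%classic `*` tbox n r.
Proof.
apply/seteqP; split => [[x t]|[x t] []] /=.
  move=> xt; split; first by rewrite /= in_itv/= -ler_norml; exact: (xt ord0).
  by move=> i; have := xt (lift ord0 i); rewrite tnthS.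
rewrite in_itv /= -ler_norml => xr tr i.
have [->|[j ->]] : i = ord0 \/ exists j, i = lift ord0 j.
- by case: (unliftP ord0 i) => [j ->|->]; [right; exists j|left].
- by [].
- by rewrite tnthS.
Qed.

Lemma measurable_tbox n r : measurable (tbox n r).
Proof.
rewrite (_ : tbox n r =
    \bigcap_(i in [set: 'I_n]) ((tnth (T:=R))^~ i @^-1` `[- r, r]%classic)).
  apply: fin_bigcap_measurable => // i _; rewrite -[X in measurable X]setTI.
  by apply: measurable_tnth => //; exact: measurable_itv.
apply/seteqP; split=> x xr i => [_|]; last have := xr i I.
- by rewrite /= in_itv/= -ler_norml; exact: xr.
- by rewrite /= in_itv/= -ler_norml.
Qed.

Lemma lebesgue_tuple_tbox n (r : R) : 0 <= r ->
  lebesgue_tuple n (tbox n r) = ((2 * r) ^+ n)%:E.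
Proof.
move=> r0; elim: n => [|n IHn] /=.
  by rewrite expr0 diracE mem_set// => -[].
rewrite /lebesgue_cons /pushforward tbox_cons product_measure1E//.
- rewrite exprS EFinM; congr (_ * _)%E; last exact: IHn.
  apply: etrans (lebesgue_measure_itv `[- r, r]) _; rewrite /= lte_fin; case: ltP => rr.
    by rewrite -EFinB opprK mulrDl !mul1r.
  have -> : r = 0 by lra.
  by rewrite mulr0.
- exact: measurable_tbox.
Qed.

End LebesgueTupleTheory.

Arguments tbox {R} n r _.

(** * Coordinates and boxes in a basis *)

Section Coordinates.
Context {R : realType} {H : vectType R}.
Variable e : (\dim {:H}).-tuple H.
Hypothesis e_basis : basis_of fullv e.
Local Notation Rd := ((\dim {:H}).-tuple (measurableTypeR R)).

Definition coords (y : H) : Rd := [tuple coord e i y | i < \dim {:H}].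

Lemma lincombK (x : Rd) : coords (lincomb e x) = x.
Proof.
apply: eq_from_tnth => i; rewrite tnth_mktuple /lincomb.
under eq_bigr do rewrite (tnth_nth (0 : H) e).
by rewrite coord_sum_free// (basis_free e_basis).
Qed.

Lemma coordsK (y : H) : lincomb e (coords y) = y.
Proof.
rewrite [RHS](coord_basis e_basis (memvf y)).
by apply: eq_bigr => i _; rewrite tnth_mktuple (tnth_nth (0 : H) e).
Qed.

Lemma coord_lincomb (x : Rd) i : coord e i (lincomb e x) = tnth x i.
Proof. by have := congr1 (fun t : Rd => tnth t i) (lincombK x); rewrite tnth_mktuple. Qed.

Lemma measurable_coord (i : 'I_(\dim {:H})) :
  measurable_fun [set: borel e] (coord e i : borel e -> R).
Proof.
move=> _ A mA; rewrite setTI.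
rewrite /measurable/= /borel_measurable/= /image_set_system/= setTI.
rewrite (_ : _ @^-1` _ = (fun t : Rd => tnth t i) @^-1` A); last first.
  by apply/seteqP; split=> x; rewrite /preimage /= coord_lincomb.
by rewrite -[X in measurable X]setTI; exact: measurable_tnth.
Qed.

Lemma measurable_to_borel d (T : measurableType d) (f : T -> borel e) :
  (forall i, measurable_fun [set: T] (fun x => coord e i (f x) : R)) ->
  measurable_fun [set: T] f.
Proof.
move=> mf.
have -> : f = lincomb_borel e \o (coords \o f).
  by apply/funext => x /=; rewrite /lincomb_borel coordsK.
apply: measurableT_comp; first exact: measurable_lincomb.
apply/measurable_fun_tnthP => i.
rewrite [X in measurable_fun _ X](_ : _ = (fun x => coord e i (f x))).
  exact: mf.
by apply/funext => x; rewrite /= tnth_mktuple.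
Qed.

Lemma lincombD (x v : Rd) : lincomb e (addt x v) = lincomb e x + lincomb e v.
Proof.
by rewrite -big_split; apply: eq_bigr => i _; rewrite tnth_mktuple scalerDl.
Qed.

Lemma lebesgue_borel_translate (v : H) (A : set (borel e)) : measurable A ->
  lebesgue_borel e [set y : borel e | A ((y : H) + v)] = lebesgue_borel e A.
Proof.
move=> mA; rewrite /lebesgue_borel /pushforward.
rewrite -[RHS](lebesgue_tuple_translate (coords v)).
  by congr (lebesgue_tuple _ _); apply/seteqP; split=> x;
    rewrite /preimage /= /lincomb_borel lincombD coordsK.
by rewrite -[X in measurable X]setTI; exact: measurable_lincomb.
Qed.

Definition box (r : R) : set (borel e) := [set y | forall i, `|coord e i (y : H)| <= r].

Lemma preimage_box r : lincomb_borel e @^-1` box r = tbox _ r.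
Proof.
by apply/seteqP; split=> x xr i; have := xr i; rewrite /lincomb_borel coord_lincomb.
Qed.

Lemma measurable_box r : measurable (box r).
Proof.
rewrite /measurable/= /borel_measurable/= /image_set_system/= setTI.
by have := preimage_box r; rewrite /lincomb_borel => ->; exact: measurable_tbox.
Qed.

Lemma lebesgue_box r : 0 <= r ->
  lebesgue_borel e (box r) = ((2 * r) ^+ \dim {:H})%:E.
Proof.
move=> r0.
by rewrite /lebesgue_borel /pushforward preimage_box lebesgue_tuple_tbox.
Qed.

Lemma box_bigcup : \bigcup_k box k%:R = setT.
Proof.
apply/seteqP; split=> // y _.
pose M := \sum_(i < \dim {:H}) `|coord e i y|.
exists (Num.truncn M).+1 => // i.
apply: (@le_trans _ _ M); last exact/ltW/truncnS_gt.
by rewrite /M (bigD1 i)//= lerDl sumr_ge0.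
Qed.

Lemma sigma_finite_lebesgue_borel : sigma_finite setT (lebesgue_borel e).
Proof.
exists (fun k => box k%:R) => [|k]; first by rewrite box_bigcup.
by split; [exact: measurable_box|rewrite lebesgue_box ?ltry].
Qed.

End Coordinates.

Arguments box {R H} e r _.

(** * Translation-invariant measures *)

Section LinearMaps.
Context {R : realType}.

Section TwoBases.
Context {H H' : vectType R}.
Variables (e : (\dim {:H}).-tuple H) (e' : (\dim {:H'}).-tuple H').
Hypotheses (e_basis : basis_of fullv e) (e'_basis : basis_of fullv e').

Lemma coord_lfun (T : 'Hom(H, H')) (y : H) i :
  coord e' i (T y) = \sum_(k < \dim {:H}) coord e k y * coord e' i (T e`_k).
Proof.
rewrite {1}(coord_basis e_basis (memvf y)) !linear_sum/=.
by apply: eq_bigr => k _; rewrite !linearZ.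
Qed.

Lemma measurable_lfun (T : 'Hom(H, H')) :
  measurable_fun [set: borel e] (T : borel e -> borel e').
Proof.
apply: measurable_to_borel => // i.
rewrite [X in measurable_fun _ X](_ : _ = (fun y : borel e =>
   \sum_(k < \dim {:H}) coord e k y * coord e' i (T e`_k))); last first.
  by apply/funext => y; exact: coord_lfun.
apply: measurable_sum => k; apply: measurable_funM; last exact: measurable_cst.
exact: measurable_coord.
Qed.

(** Boxes play the role of balls, and this is the boundedness of [T]. The sum of the absolute values
    of all matrix entries serves as [K]. The sign of [r] is harmless: a point of the box with at
    least one coordinate forces [0 <= r]. *)
Lemma box_lfun (T : 'Hom(H, H')) : exists2 K : R, 0 <= K &
  forall r y, box e r y -> box e' (K * r) (T y).
Proof.
pose a i k := `|coord e' i (T e`_k)|.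
exists (\sum_i \sum_(k < \dim {:H}) a i k).
  by apply: sumr_ge0 => i _; apply: sumr_ge0 => k _; exact: normr_ge0.
move=> r y yr i; rewrite coord_lfun (bigD1 i)//= mulrDl.
rewrite ler_wpDr//.
  rewrite mulr_suml; apply: sumr_ge0 => j _; rewrite mulr_suml.
  apply: sumr_ge0 => k _; apply: mulr_ge0; first exact: normr_ge0.
  exact: le_trans (normr_ge0 _) (yr k).
rewrite mulr_suml; apply: (le_trans (ler_norm_sum _ _ _)).
apply: ler_sum => k _; rewrite normrM mulrC ler_wpM2l//; exact: yr.
Qed.

End TwoBases.

Lemma measurable_addv (H : vectType R) (e : (\dim {:H}).-tuple H)
    (e_basis : basis_of fullv e) d (T : measurableType d) (f g : T -> borel e) :
  measurable_fun [set: T] f -> measurable_fun [set: T] g ->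
  measurable_fun [set: T] (fun x => (f x : H) + (g x : H) : borel e).
Proof.
move=> mf mg; apply: measurable_to_borel => // i.
rewrite [X in measurable_fun _ X](_ : _ =
    (fun x => coord e i (f x) + coord e i (g x))); last first.
  by apply/funext => y; rewrite linearD.
by apply: measurable_funD;
  [apply: (measurableT_comp (measurable_coord e_basis i) mf)
  |apply: (measurableT_comp (measurable_coord e_basis i) mg)].
Qed.

End LinearMaps.

Notation vec H := (borel (vbasis {:H})).

Section CanonicalLebesgue.
Context {R : realType}.

(** The basis [vbasis] is available on every space, in particular on the subspaces that the
    induction produces, and another basis only changes the measure by a positive factor. *)
Definition leb (H : vectType R) : set (vec H) -> \bar R :=
  lebesgue_borel (vbasis {:H}).
Arguments leb H _ : clear implicits.

HB.instance Definition _ (H : vectType R) := Measure.on (leb H).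

Let leb_sigma_finite (H : vectType R) : sigma_finite setT (leb H).
Proof. exact: sigma_finite_lebesgue_borel (vbasisP _). Qed.

HB.instance Definition _ (H : vectType R) :=
  Measure_isSigmaFinite.Build _ _ _ (leb H) (leb_sigma_finite H).

Lemma measurable_vec_lfun (H H' : vectType R) (T : 'Hom(H, H')) :
  measurable_fun [set: vec H] (T : vec H -> vec H').
Proof. by apply: measurable_lfun; exact: vbasisP. Qed.

Lemma measurable_vec_add (H : vectType R) d (T : measurableType d)
    (f g : T -> vec H) :
  measurable_fun [set: T] f -> measurable_fun [set: T] g ->
  measurable_fun [set: T] (fun x => (f x : H) + (g x : H) : vec H).
Proof. exact/measurable_addv/vbasisP. Qed.

Lemma measurable_vec_opp (H : vectType R) d (T : measurableType d)
    (f : T -> vec H) :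
  measurable_fun [set: T] f -> measurable_fun [set: T] (fun x => - (f x : H) : vec H).
Proof.
move=> mf; have -> : (fun x => - (f x : H) : vec H) =
    (- \1%VF : 'End(H)) \o (f : T -> H).
  by apply/funext => x; rewrite /= opp_lfunE id_lfunE.
exact: measurableT_comp (measurable_vec_lfun _) mf.
Qed.

Lemma leb_translate (H : vectType R) (v : H) (A : set (vec H)) : measurable A ->
  leb H [set y : vec H | A ((y : H) + v)] = leb H A.
Proof. exact/lebesgue_borel_translate/vbasisP. Qed.

End CanonicalLebesgue.

Arguments leb {R} H _.

Section SigmaFinite.
Context d {T : measurableType d} {R : realType} (nu : {measure set T -> \bar R}).

(** A copy of [nu] under a name to which the sigma-finite structure can be attached, for measures
    whose sigma-finiteness is only a hypothesis. *)
Definition sigma_finite_of of sigma_finite setT nu : set T -> \bar R := nu.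

Variable nu_fin : sigma_finite setT nu.

HB.instance Definition _ := Measure.on (sigma_finite_of nu_fin).
HB.instance Definition _ :=
  Measure_isSigmaFinite.Build _ _ _ (sigma_finite_of nu_fin) nu_fin.

End SigmaFinite.

Section TranslationInvariant.
Context {R : realType} {H : vectType R}.
Local Open Scope ereal_scope.

Definition translation_invariant (mu : set (vec H) -> \bar R) :=
  forall (v : H) (A : set (vec H)), measurable A ->
    mu [set y : vec H | A ((y : H) + v)%R] = mu A.

Lemma tonelli_sections d1 d2 (T1 : measurableType d1) (T2 : measurableType d2)
    (mu : {sigma_finite_measure set T1 -> \bar R})
    (nu : {sigma_finite_measure set T2 -> \bar R}) (S : set (T1 * T2)) :
  measurable S ->
  \int[mu]_x nu (xsection S x) = \int[nu]_y mu (ysection S y).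
Proof.
move=> mS; transitivity ((mu \x nu) S) => //.
transitivity ((mu \x^ nu) S) => //.
by apply: product_measure_unique => // A B mA mB; exact: product_measure2E.
Qed.

(* Both sides are the [mu \x nu]-measure of [{(x, y) | x \in A, x + y \in E}]:
   slicing in [x] gives the left one, while slicing in [y], translating [x] by
   [- y] and slicing in [x] again gives the right one. *)
Lemma translation_invariant_opp
    (mu nu : {sigma_finite_measure set (vec H) -> \bar R}) (A E : set (vec H)) :
  translation_invariant mu -> translation_invariant nu ->
  measurable A -> measurable E ->
  nu E * mu A = nu [set y : vec H | A (- (y : H))%R] * mu E.
Proof.
move=> mu_inv nu_inv mA mE.
pose S1 : set (vec H * vec H) := [set z | A z.1 /\ E ((z.1 : H) + (z.2 : H))%R].
pose S2 : set (vec H * vec H) := [set z | E z.1 /\ A ((z.1 : H) - (z.2 : H))%R].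
have mS1 : measurable S1.
  apply: measurableI.
    by rewrite -[X in measurable X]setTI; exact: (@measurable_fst _ _ (vec H) (vec H)).
  rewrite -[X in measurable X]setTI.
  exact: (@measurable_vec_add _ H _ _ fst snd).
have mS2 : measurable S2.
  apply: measurableI.
    by rewrite -[X in measurable X]setTI; exact: (@measurable_fst _ _ (vec H) (vec H)).
  have mB := @measurable_vec_add _ H _ (vec H * vec H)%type fst
    (fun z => - (snd z : H) : vec H)%R measurable_fst (measurable_vec_opp measurable_snd).
  by rewrite -[X in measurable X]setTI; exact: mB.
have slice (nu' : {sigma_finite_measure set (vec H) -> \bar R}) B (k : \bar R) :
    measurable B -> 0 <= k -> \int[nu']_x (k * (\1_B x)%:E) = k * nu' B.
  move=> mB k0; rewrite ge0_integralZl//.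
  - by rewrite integral_indic// setIT.
  - exact/measurable_EFinP/measurable_indic.
transitivity (\int[mu]_x nu (xsection S1 x)).
  rewrite -slice//; apply: eq_integral => x _; rewrite indicE.
  have [/set_mem Ax|nAx] := boolP (x \in A); rewrite ?mule1 ?mule0.
    rewrite -(nu_inv x)//; congr (nu _).
    by apply/seteqP; split=> y; rewrite xsectionE /preimage /= addrC //; case.
  rewrite (_ : xsection _ _ = set0) ?measure0//.
  by apply/seteqP; split=> y//; rewrite xsectionE => -[/= /mem_set]; rewrite (negPf nAx).
rewrite tonelli_sections//.
transitivity (\int[nu]_y mu (ysection S2 y)).
  apply: eq_integral => y _; rewrite -[RHS](mu_inv y); last exact: measurable_ysection.
  congr (mu _); apply/seteqP; split=> x /= /ysectionP[/= ? ?];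
    apply/ysectionP; split=> //=; first by rewrite addrK.
  by rewrite -(addrK (y : H) (x : H)).
rewrite -tonelli_sections// -slice//.
apply: eq_integral => x _; rewrite indicE.
have [/set_mem Ax|nAx] := boolP (x \in E); rewrite ?mule1 ?mule0.
  rewrite -(nu_inv (- (x : H))%R).
    congr (nu _).
    by apply/seteqP; split=> y; rewrite xsectionE /preimage /= opprB //; case.
  by rewrite -[X in measurable X]setTI;
    exact: (measurable_vec_opp (@measurable_id _ (vec H) setT)).
rewrite (_ : xsection _ _ = set0) ?measure0//.
by apply/seteqP; split=> y//; rewrite xsectionE => -[/= /mem_set]; rewrite (negPf nAx).
Qed.

Lemma leb_translation_invariant : translation_invariant (leb H).
Proof. by move=> v A mA; exact: leb_translate. Qed.

Lemma leb_box r : (0 <= r)%R -> leb H (box (vbasis {:H}) r) = ((2 * r) ^+ \dim {:H})%:E.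
Proof. by move=> r0; rewrite /leb lebesgue_box//; exact: vbasisP. Qed.

(** The identity of [translation_invariant_opp] involves the reflection of [A]. Applied to [leb H]
    against itself, it shows that [leb H] is symmetric; applied to [nu] against [leb H] on the box
    [Q], it then gives the ratio [nu Q / q]. *)
Lemma translation_invariant_uniq (nu : {measure set (vec H) -> \bar R}) :
  sigma_finite setT nu -> translation_invariant nu -> nu setT != 0 ->
  exists2 c : R, (0 < c)%R & forall A, measurable A -> nu A = c%:E * leb H A.
Proof.
move=> nu_fin nu_inv nu0; pose nu' := sigma_finite_of nu_fin.
pose Q := box (vbasis {:H}) 1.
have mQ : measurable Q by exact: measurable_box (vbasisP _) _.
pose q : R := ((2 * 1) ^+ \dim {:H})%R.
have q0 : (0 < q)%R by rewrite /q mulr1 exprn_gt0// ltr0n.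
have lebQ : leb H Q = q%:E by rewrite leb_box ?ler01.
have cancelq (x y : \bar R) : q%:E * x = q%:E * y -> x = y.
  move=> /(congr1 (mule (q^-1)%:E)); rewrite !muleA -EFinM mulVf ?gt_eqF//.
  by rewrite !mul1e.
have lebN (A : set (vec H)) : measurable A ->
    leb H [set y : vec H | A (- (y : H))%R] = leb H A.
  move=> mA; have := translation_invariant_opp leb_translation_invariant
    leb_translation_invariant mA mQ.
  by rewrite /= lebQ [RHS]muleC => /cancelq.
have mN (A : set (vec H)) : measurable A -> measurable [set y : vec H | A (- (y : H))%R].
  have mid : measurable_fun [set: vec H] (fun y => y) by exact: measurable_id.
  by move=> mA; rewrite -[X in measurable X]setTI; exact: (measurable_vec_opp mid).
have nuq (A : set (vec H)) : measurable A -> nu Q * leb H A = q%:E * nu A.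
  move=> mA; have := translation_invariant_opp (mu := leb H) (nu := nu')
    leb_translation_invariant nu_inv (mN _ mA) mQ.
  rewrite /= lebN// [RHS]muleC lebQ; congr (_ = _ * nu _).
  by apply/seteqP; split=> y /=; rewrite opprK.
have nuQ0 : nu Q != 0.
  apply: contra nu0 => /eqP nuQ0; apply/eqP/cancelq.
  by rewrite -nuq// nuQ0 mul0e mule0.
(* If [nu Q] were infinite, [nuq] would make [nu] infinite on every set of positive Lebesgue
   measure. The sets [F k], of finite [nu]-measure, would all be Lebesgue null, and so would [Q],
   which they cover. *)
have nuQy : nu Q < +oo.
  rewrite ltey; apply/eqP => nuQy.
  have [F FT Foo] := nu_fin.
  have lebF k : leb H (F k) = 0.
    have [mF Fy] := Foo k; apply/eqP/negPn/negP => F0; move: Fy.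
    have : q%:E * nu (F k) = +oo.
      by rewrite -nuq// nuQy gt0_mulye// lt_neqAle eq_sym F0/=.
    have [->|] := eqVneq (nu (F k)) +oo; first by rewrite ltxx.
    move=> Fy + _; have [|] := boolP (nu (F k) \is a fin_num).
      by move=> /fineK <-; rewrite -EFinM.
    by rewrite ge0_fin_numE// ltey Fy.
  have : leb H Q <= \sum_(k <oo) leb H (F k).
    apply: measure_sigma_subadditive => //; first by move=> k; case: (Foo k).
    by rewrite -FT.
  rewrite eseries0 => [|k _ _]; last exact: lebF.
  by rewrite lebQ lee_fin leNgt q0.
have nuQf : nu Q \is a fin_num by rewrite ge0_fin_numE.
exists (fine (nu Q) / q)%R.
  by rewrite divr_gt0// fine_gt0// nuQy lt_neqAle eq_sym nuQ0 measure_ge0.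
move=> A mA; apply: cancelq; rewrite -nuq// muleA -EFinM mulrCA divff ?gt_eqF//.
by rewrite mulr1 fineK.
Qed.

End TranslationInvariant.

(** * Changes of variables *)

Section ChangeOfVariables.
Context {R : realType}.
Local Open Scope ereal_scope.

Lemma ge0_integral_measure_scale d (T : measurableType d)
    (m1 m2 : {measure set T -> \bar R}) (c : R) (f : T -> \bar R) :
  (0 <= c)%R -> (forall A, measurable A -> m1 A = c%:E * m2 A) ->
  measurable_fun setT f -> (forall x, 0 <= f x) ->
  \int[m1]_x f x = c%:E * \int[m2]_x f x.
Proof.
move=> c0 m12 mf f0.
rewrite (eq_measure_integral (mscale (NngNum c0) m2)); last first.
  by move=> A mA _; rewrite m12.
by rewrite ge0_integral_mscale.
Qed.

Lemma leb_setT_neq0 (H : vectType R) : leb H setT != 0.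
Proof.
apply/eqP => H0.
have : leb H (box (vbasis {:H}) 1) <= leb H setT.
  by apply: le_measure => //; rewrite inE//; exact: measurable_box (vbasisP _) _.
by rewrite H0 leb_box// mulr1 lee_fin leNgt exprn_gt0// ltr0n.
Qed.

(** The common source of the change-of-variables formulas: the pushforward of [mu] by [g] is
    translation invariant, hence a multiple of [leb H]. The left inverse [h] of [g] pulls a sequence
    exhausting [X] back to [H], which makes the pushforward sigma-finite. *)
Lemma leb_pushforward (H : vectType R) d (X : measurableType d)
    (mu : {measure set X -> \bar R}) (g : X -> vec H) (h : vec H -> X) :
  sigma_finite setT mu -> measurable_fun setT g -> measurable_fun setT h -> cancel g h ->
  (forall (v : H) (A : set (vec H)), measurable A ->
    mu [set x | A ((g x : H) + v)%R] = mu [set x | A (g x)]) ->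
  mu setT != 0 ->
  exists2 c : R, (0 < c)%R & forall f : vec H -> \bar R,
    measurable_fun setT f -> (forall y, 0 <= f y) ->
    \int[leb H]_y f y = c%:E * \int[mu]_x f (g x).
Proof.
move=> [F FT Foo] mg mh gK mu_inv mu0.
pose nu : {measure set (vec H) -> \bar R} :=
  measure_function_pushforward__canonical__measure_function_Measure mu mg.
have nuE A : nu A = mu (g @^-1` A) by [].
have nu_fin : sigma_finite setT nu.
  exists (fun k => h @^-1` F k) => [|k].
    by rewrite -preimage_bigcup -FT preimage_setT.
  have [mF Fy] := Foo k; split.
    by rewrite -[X in measurable X]setTI; exact: mh.
  rewrite nuE (_ : g @^-1` _ = F k)//.
  by apply/seteqP; split=> x; rewrite /preimage /= gK.
have [//|c c0 nuc] := translation_invariant_uniq nu_fin mu_inv.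
exists c^-1%R; first by rewrite invr_gt0.
move=> f mf f0.
have : \int[nu]_y f y = c%:E * \int[leb H]_y f y.
  by apply: ge0_integral_measure_scale => //; exact: ltW.
rewrite ge0_integral_pushforward// preimage_setT => ->.
by rewrite muleA -EFinM mulVf ?gt_eqF// mul1e.
Qed.

Lemma leb_bijective (H H' : vectType R) (T : 'Hom(H, H')) :
  lker T = 0%VS -> limg T = fullv ->
  exists2 c : R, (0 < c)%R & forall f : vec H' -> \bar R,
    measurable_fun setT f -> (forall y, 0 <= f y) ->
    \int[leb H']_y f y = c%:E * \int[leb H]_x f (T x).
Proof.
move=> /eqP T0 TT.
apply: (@leb_pushforward _ _ _ (leb H) (T : vec H -> vec H') (T^-1%VF : vec H' -> vec H)).
- exact: sigma_finiteT.
- exact: measurable_vec_lfun.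
- exact: measurable_vec_lfun.
- exact: lker0_lfunK.
- move=> v A mA.
  rewrite -[RHS](leb_translation_invariant (T^-1%VF v : H) (A := [set x | A (T x)])).
    congr (leb H _); apply/seteqP; split=> x;
      by rewrite /= linearD/= limg_lfunVK// TT memvf.
  by rewrite -[X in measurable X]setTI; exact: measurable_vec_lfun.
- exact: leb_setT_neq0.
Qed.

(* Canonical structure inference does not find this instance for [m1 \x m2]. *)
Lemma sigma_finite_product d1 d2 (T1 : measurableType d1)
    (T2 : measurableType d2) (m1 : {sigma_finite_measure set T1 -> \bar R})
    (m2 : {sigma_finite_measure set T2 -> \bar R}) :
  sigma_finite setT (m1 \x m2).
Proof.
have /sigma_finiteP[F [TF ndF Foo]] := sigma_finiteT m1.
have /sigma_finiteP[G [TG ndG Goo]] := sigma_finiteT m2.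
exists (fun k => F k `*` G k) => [|k]; last first.
  have [[mF Fkoo] [mG Gkoo]] := (Foo k, Goo k).
  split; first exact: measurableX.
  by rewrite product_measure1E// lte_mul_pinfty// ge0_fin_numE.
apply/seteqP; split=> // -[x y] _.
have [i _ Fix] : (\bigcup_i F i) x by rewrite -TF.
have [j _ Gjy] : (\bigcup_i G i) y by rewrite -TG.
exists (maxn i j) => //; split.
  by move: x Fix; exact/subsetPset/ndF/leq_maxl.
by move: y Gjy; exact/subsetPset/ndG/leq_maxr.
Qed.

(** The hypotheses say that [H] is the direct sum of [H1] and [H2]. A translation by [v] becomes the
    shift by [(p1 v, p2 v)], under which the product measure is invariant since it is so on
    rectangles. *)
Lemma leb_fubini (H H1 H2 : vectType R) (i1 : 'Hom(H1, H)) (i2 : 'Hom(H2, H))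
    (p1 : 'Hom(H, H1)) (p2 : 'Hom(H, H2)) :
  (forall w u, p1 (i1 w + i2 u)%R = w) -> (forall w u, p2 (i1 w + i2 u)%R = u) ->
  (forall y, (i1 (p1 y) + i2 (p2 y))%R = y) ->
  exists2 c : R, (0 < c)%R & forall f : vec H -> \bar R,
    measurable_fun setT f -> (forall y, 0 <= f y) ->
    \int[leb H]_y f y = c%:E * \int[leb H2]_u \int[leb H1]_w f (i1 w + i2 u)%R.
Proof.
move=> p1K p2K pK.
pose g (z : vec H1 * vec H2) : vec H := (i1 z.1 + i2 z.2)%R.
pose h (y : vec H) : vec H1 * vec H2 := (p1 y, p2 y).
have mg : measurable_fun setT g.
  apply: measurable_vec_add.
    exact: measurableT_comp (measurable_vec_lfun i1) measurable_fst.
  exact: measurableT_comp (measurable_vec_lfun i2) measurable_snd.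
have mh : measurable_fun setT h.
  by apply: measurable_fun_pair; exact: measurable_vec_lfun.
pose mu : {measure set (vec H1 * vec H2)%type -> \bar R} := leb H1 \x leb H2.
have [|||c c0 cE] := @leb_pushforward H _ _ mu g h (sigma_finite_product _ _) mg mh.
- by move=> [w u]; rewrite /h /g p1K p2K.
- move=> v A mA.
  pose t (z : vec H1 * vec H2) : vec H1 * vec H2 := ((z.1 : H1) + p1 v, (z.2 : H2) + p2 v)%R.
  have mt : measurable_fun setT t.
    apply: measurable_fun_pair.
      by apply: measurable_vec_add; [exact: measurable_fst|exact: measurable_cst].
    by apply: measurable_vec_add; [exact: measurable_snd|exact: measurable_cst].
  pose nu : {measure set (vec H1 * vec H2)%type -> \bar R} :=
    measure_function_pushforward__canonical__measure_function_Measure mu mt.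
  have gD (w : H1) (u : H2) :
      (i1 (w + p1 v) + i2 (u + p2 v) = i1 w + i2 u + v)%R.
    by rewrite -[in RHS](pK v) !linearD/= addrACA.
  have mgA : measurable [set x | A (g x)].
    by rewrite -[X in measurable X]setTI; exact: mg.
  rewrite [RHS](@product_measure_unique _ _ _ _ _ (leb H1) (leb H2) nu)//.
    rewrite /nu /= /pushforward; congr (mu _).
    apply/seteqP; split=> -[w u]; rewrite /preimage /= /g /=; by rewrite gD.
  move=> B C mB mC; rewrite /nu /= /pushforward.
  rewrite (_ : t @^-1` _ =
    [set w | B ((w : H1) + p1 v)%R] `*` [set u | C ((u : H2) + p2 v)%R]).
  2: by apply/seteqP; split=> x.
  have mshift (H0 : vectType R) (a : H0) (D : set (vec H0)) : measurable D ->
      measurable [set y : vec H0 | D ((y : H0) + a)%R].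
    move=> mD; rewrite -[X in measurable X]setTI.
    exact: (@measurable_vec_add _ H0 _ (vec H0) idfun (cst a)
      (@measurable_id _ _ _) (@measurable_cst _ _ _ _ _ _)).
  apply: (etrans (product_measure1E (leb H1) (leb H2) (mshift _ _ _ mB) (mshift _ _ _ mC))).
  by congr (_ * _); exact: leb_translate.
- apply/eqP => mu0; have /negP := mule_neq0 (leb_setT_neq0 H1) (leb_setT_neq0 H2).
  by apply; apply/eqP; rewrite -[RHS]mu0 -setXTT; apply/esym/product_measure1E.
exists c => // f mf f0; rewrite cE//; congr (_ * _).
rewrite (fubini_tonelli2 (f \o g))//.
- exact: measurableT_comp.
- by move=> x; exact: f0.
Qed.

End ChangeOfVariables.

(** * Hoelder's inequality *)

Section EReal.
Context {R : realType}.
Local Open Scope ereal_scope.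
Implicit Types (r s t : R).

Lemma ge0_poweRD (x : \bar R) r s : 0 <= x -> (0 <= r)%R -> (0 <= s)%R ->
  x `^ (r + s) = x `^ r * x `^ s.
Proof.
move=> x0 r0 s0; have [->|xN0] := eqVneq x 0; last first.
  by rewrite poweRD//; exact: nneg_neq0_poweRD_def.
have [rs0|rs0] := eqVneq (r + s)%R 0%R; last first.
  by rewrite poweRD//; exact: add_neq0_poweRD_def.
have [-> ->] : r = 0%R /\ s = 0%R by split; lra.
by rewrite addr0 poweRe0 mule1.
Qed.

Lemma prod_poweR (I : Type) (u : seq I) (P : pred I) (F : I -> \bar R) r :
  (forall i, 0 <= F i) ->
  (\prod_(i <- u | P i) F i) `^ r = \prod_(i <- u | P i) (F i `^ r).
Proof.
move=> F0; elim: u => [|i u IHu]; first by rewrite !big_nil poweR1r.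
rewrite !big_cons; case: ifP => // _; rewrite poweRM// ?IHu//.
exact: prode_ge0.
Qed.

Lemma emeasurable_prod d (T : measurableType d) (I : Type) (u : seq I) (F : I -> T -> \bar R) :
  (forall i, measurable_fun setT (F i)) ->
  measurable_fun setT (fun x => \prod_(i <- u) F i x).
Proof.
move=> mF; elim: u => [|i u IHu].
  by under eq_fun do rewrite big_nil; exact: measurable_cst.
by under eq_fun do rewrite big_cons; exact: emeasurable_funM.
Qed.

Lemma measurable_fun_poweR d (T : measurableType d) (f : T -> \bar R) r :
  measurable_fun setT f -> measurable_fun setT (fun x => f x `^ r).
Proof. by move=> mf; exact: measurableT_comp (measurable_poweR r) mf. Qed.

(** Young's inequality for the conjugate exponents 1/s and 1/t, applied to [x]^ s[and]y [^ t]; an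
    infinite argument makes the right side infinite. *)
Lemma poweR_young (x y : \bar R) s t : 0 <= x -> 0 <= y -> (0 < s)%R -> (0 < t)%R ->
  (s + t = 1)%R -> x `^ s * y `^ t <= s%:E * x + t%:E * y.
Proof.
case: x => [x| |]//; case: y => [y| |]// x0 y0 s0 t0 st1.
- rewrite !poweR_EFin -!EFinM -EFinD lee_fin; rewrite !lee_fin in x0 y0.
  have /= := @conjugate_powR R (powR x s) (powR y t) s^-1%R t^-1%R.
  rewrite !powR_ge0 !invr_gt0 !invrK -!powRrM !divff ?gt_eqF// !powRr1//.
  by move=> /(_ isT isT s0 t0 st1); rewrite mulrC [(s * _)%R]mulrC [(t * _)%R]mulrC.
- by rewrite gt0_muley ?lte_fin// addey -?EFinM// ?leey.
- by rewrite gt0_muley ?lte_fin// addye -?EFinM// ?leey.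
- by rewrite !gt0_muley ?lte_fin// leey.
Qed.

End EReal.

Section Hoelder.
Context d {T : measurableType d} {R : realType} (mu : {measure set T -> \bar R}).
Local Open Scope ereal_scope.

Lemma integral_poweR_hoelder (D : set T) (f g : T -> \bar R) (s t : R) :
  measurable D -> measurable_fun setT f -> measurable_fun setT g ->
  (forall x, 0 <= f x) -> (forall x, 0 <= g x) ->
  (0 < s)%R -> (0 < t)%R -> (s + t = 1)%R ->
  \int[mu]_(x in D) (f x `^ s * g x `^ t) <=
  (\int[mu]_(x in D) f x) `^ s * (\int[mu]_(x in D) g x) `^ t.
Proof.
move=> mD mf mg f0 g0 s0 t0 st1.
have mfs := measurable_fun_poweR s mf; have mgt := measurable_fun_poweR t mg.
have mfg : measurable_fun setT (fun x => f x `^ s * g x `^ t).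
  exact: emeasurable_funM.
have fg0 x : 0 <= f x `^ s * g x `^ t by rewrite mule_ge0// poweR_ge0.
(* Used with [h] equal to [f] or [g]: where it vanishes, the product vanishes too, even if the other
   factor is infinite, because zero times infinity is 0. *)
have null (h : T -> \bar R) r : measurable_fun setT h -> (forall x, 0 <= h x) ->
    (0 < r)%R -> \int[mu]_(x in D) h x = 0 ->
    (forall x, h x `^ r = 0 -> f x `^ s * g x `^ t = 0) ->
    \int[mu]_(x in D) (f x `^ s * g x `^ t) = 0.
  move=> mh h0 r0 h_int0 hfg.
  transitivity (\int[mu]_(x in D) cst 0 x); last exact: integral0.
  apply: ge0_ae_eq_integral => //.
    exact: measurable_funTS.
  have /(ae_eq_integral_abs mu mD) : \int[mu]_(x in D) `|h x| = 0.
    by rewrite -h_int0; apply: eq_integral => x _; rewrite gee0_abs.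
  move=> /(_ (measurable_funTS mh)); apply: filterS => x hx Dx.
  by rewrite hfg// hx// poweR0r// gt_eqF.
set A := \int[mu]_(x in D) f x; set B := \int[mu]_(x in D) g x.
have A0 : 0 <= A by exact: integral_ge0.
have B0 : 0 <= B by exact: integral_ge0.
have [A_eq0|An0] := eqVneq A 0.
  rewrite (null f s)//; first by rewrite mule_ge0// poweR_ge0.
  by move=> x ->; rewrite mul0e.
have [B_eq0|Bn0] := eqVneq B 0.
  rewrite (null g t)//; first by rewrite mule_ge0// poweR_ge0.
  by move=> x ->; rewrite mule0.
have Agt0 : 0 < A by rewrite lt_neqAle eq_sym An0.
have Bgt0 : 0 < B by rewrite lt_neqAle eq_sym Bn0.
have [->|Ay] := eqVneq A +oo.
  by rewrite poweRyr ?gt_eqF// gt0_mulye ?leey// poweR_gt0.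
have [->|By] := eqVneq B +oo.
  by rewrite poweRyr ?gt_eqF// gt0_muley ?leey// poweR_gt0.
have [a a0 AE] : exists2 a : R, (0 < a)%R & A = a%:E.
  by exists (fine A); rewrite ?fineK// ?ge0_fin_numE// ?fine_gt0// ltey Ay ?Agt0.
have [b b0 BE] : exists2 b : R, (0 < b)%R & B = b%:E.
  by exists (fine B); rewrite ?fineK// ?ge0_fin_numE// ?fine_gt0// ltey By ?Bgt0.
(* [k] is the desired bound. After dividing [f] by [a] and [g] by [b], both integrals are 1, and the
   pointwise Young inequality integrates to [k * (s + t) = k]. *)
pose k : R := (powR a s * powR b t)%R.
have k0 : (0 <= k)%R by rewrite mulr_ge0// powR_ge0.
have ksa0 : (0 <= k * s / a)%R.
  by rewrite divr_ge0 ?(ltW a0)// mulr_ge0// ltW.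
have ktb0 : (0 <= k * t / b)%R.
  by rewrite divr_ge0 ?(ltW b0)// mulr_ge0// ltW.
apply: (@le_trans _ _ (\int[mu]_(x in D)
    ((k * s / a)%:E * f x + (k * t / b)%:E * g x))).
  apply: ge0_le_integral => //.
  - exact: measurable_funTS.
  - apply: measurable_funTS; apply: emeasurable_funD;
      by apply: measurable_funeM.
  move=> x _.
  have fE : f x = a%:E * (a^-1%:E * f x).
    by rewrite muleA -EFinM divff ?gt_eqF// mul1e.
  have gE : g x = b%:E * (b^-1%:E * g x).
    by rewrite muleA -EFinM divff ?gt_eqF// mul1e.
  have fa0 : 0 <= a^-1%:E * f x by rewrite mule_ge0// lee_fin invr_ge0 ltW.
  have gb0 : 0 <= b^-1%:E * g x by rewrite mule_ge0// lee_fin invr_ge0 ltW.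
  rewrite {1}fE {1}gE [(a%:E * _) `^ s]poweRM ?lee_fin ?(ltW a0)//.
  rewrite [(b%:E * _) `^ t]poweRM ?lee_fin ?(ltW b0)// muleACA.
  rewrite (_ : a%:E `^ s * _ = k%:E) ?poweR_EFin -?EFinM//.
  rewrite (_ : _ + _ = k%:E * (s%:E * (a^-1%:E * f x) + t%:E * (b^-1%:E * g x))).
    by apply: lee_wpmul2l; [rewrite lee_fin|exact: poweR_young].
  rewrite ge0_muleDr; first last.
  - by apply: mule_ge0 gb0; rewrite lee_fin ltW.
  - by apply: mule_ge0 fa0; rewrite lee_fin ltW.
  by rewrite !muleA -!EFinM.
rewrite ge0_integralD//; last 4 first.
- by move=> x _; rewrite mule_ge0.
- by apply: measurable_funTS; exact: measurable_funeM.
- by move=> x _; rewrite mule_ge0.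
- by apply: measurable_funTS; exact: measurable_funeM.
rewrite !ge0_integralZl//.
- rewrite -/A -/B AE BE !poweR_EFin -!EFinM -EFinD lee_fin.
  rewrite !divfK ?gt_eqF// -mulrDr st1 mulr1//.
- exact: measurable_funTS.
- exact: measurable_funTS.
Qed.

End Hoelder.

(** * The localized Brascamp-Lieb inequality *)

Section Splitting.
Context {R : realType} {H : vectType R} (V : {vspace H}).

Definition incl : 'Hom(subvs_of V, H) := linfun vsval.
Definition proj : 'Hom(H, subvs_of V) := linfun (vsproj V).

Lemma inclE w : incl w = vsval w. Proof. by rewrite lfunE. Qed.

Lemma vsval_proj y : vsval (proj y) = projv V y.
Proof. by rewrite lfunE /= /vsproj unlock. Qed.

Lemma incl_mem w : incl w \in V.
Proof. by rewrite inclE subvsP. Qed.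

Lemma proj_incl w : proj (incl w) = w.
Proof. by apply: subvs_inj; rewrite vsval_proj projv_id ?incl_mem// inclE. Qed.

Lemma incl_proj y : y \in V -> incl (proj y) = y.
Proof. by move=> yV; rewrite inclE vsval_proj projv_id. Qed.

Lemma lker_incl : lker incl = 0%VS.
Proof. by apply/eqP/lker0P => x y; rewrite !inclE => /subvs_inj. Qed.

Lemma limg_incl : limg incl = V.
Proof.
apply/vspaceP => y; apply/memv_imgP/idP => [[w _ ->]|yV]; first exact: incl_mem.
by exists (proj y); rewrite ?memvf// incl_proj.
Qed.

End Splitting.

Arguments incl {R H} V.
Arguments proj {R H} V.

Section Complement.
Context {R : realType} {H : vectType R} (V : {vspace H}).

(** The projection onto [V^C] along [V]. By itself, [proj V^C] projects along the complement chosen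
    for [V^C], which need not be [V]. *)
Definition projC : 'Hom(H, subvs_of V^C) := (proj V^C \o (\1 - projv V))%VF.

Lemma projv_complement u : u \in V^C%VS -> projv V u = 0.
Proof. by rewrite -lker_proj memv_ker => /eqP. Qed.

Lemma proj_split w u : proj V (incl V w + incl V^C u) = w.
Proof.
apply: subvs_inj; rewrite vsval_proj linearD/= projv_id ?incl_mem//.
by rewrite projv_complement ?incl_mem// addr0 inclE.
Qed.

Lemma projC_split w u : projC (incl V w + incl V^C u) = u.
Proof.
rewrite comp_lfunE add_lfunE opp_lfunE id_lfunE [projv V _]linearD/= projv_id ?incl_mem//.
by rewrite projv_complement ?incl_mem// addr0 addrAC subrr add0r proj_incl.
Qed.

Lemma split_proj y : incl V (proj V y) + incl V^C (projC y) = y.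
Proof.
rewrite inclE vsval_proj comp_lfunE add_lfunE opp_lfunE id_lfunE incl_proj.
  by rewrite addrC subrK.
exact: memv_projC.
Qed.

Lemma leb_split : exists2 c : R, (0 < c)%R & forall f : vec H -> \bar R,
    measurable_fun setT f -> (forall y, 0 <= f y)%E ->
    (\int[leb H]_y f y = c%:E * \int[leb (subvs_of V^C)]_u
      \int[leb (subvs_of V)]_w f (incl V w + incl V^C u)%R)%E.
Proof.
exact: (leb_fubini proj_split projC_split split_proj).
Qed.

End Complement.

Arguments projC {R H} V.

Section BrascampLieb.
Context {R : realType} {J : finType}.
Local Open Scope ereal_scope.

(* The inequality for [F j = f j `^ p j] and [s j = (p j)^-1], over arbitrary
   bounded boxes, for maps that need not be surjective.  As [x `^ 0 = 1] for
   every [x], infinite ones included, a factor with exponent 0 drops out. *)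
Definition BL (H : vectType R) (Hj : J -> vectType R)
    (l : forall j, 'Hom(H, Hj j)) (s : J -> R) : Prop :=
  forall r : R, exists2 C : R, (0 <= C)%R &
    forall F : (forall j, vec (Hj j) -> \bar R),
      (forall j, measurable_fun setT (F j)) -> (forall j z, 0 <= F j z) ->
      \int[leb H]_(y in box (vbasis {:H}) r) \prod_j F j (l j y) `^ s j <=
      C%:E * \prod_j (\int[leb (Hj j)]_z F j z) `^ s j.

Lemma measurable_vbox (H : vectType R) r : measurable (box (vbasis {:H}) r).
Proof. exact: measurable_box (vbasisP _) _. Qed.

Lemma measurable_BL_integrand (H : vectType R) (Hj : J -> vectType R)
    (l : forall j, 'Hom(H, Hj j)) (s : J -> R) (F : forall j, vec (Hj j) -> \bar R) :
  (forall j, measurable_fun setT (F j)) ->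
  measurable_fun setT (fun y : vec H => \prod_j F j (l j y) `^ s j).
Proof.
move=> mF; apply: emeasurable_prod => j; apply: measurable_fun_poweR.
exact: measurableT_comp (mF j) (measurable_vec_lfun (l j)).
Qed.

(** For fixed [F], the integrand at the intermediate exponents is the product of the powers [a] and
    [b] of the integrands at [s0] and [s1]. The right side factors in the same way, so a single use
    of Hoelder's inequality suffices. *)
Lemma BL_interpolate (H : vectType R) (Hj : J -> vectType R)
    (l : forall j, 'Hom(H, Hj j)) (s0 s1 : J -> R) (a b : R) :
  (forall j, 0 <= s0 j)%R -> (forall j, 0 <= s1 j)%R ->
  (0 < a)%R -> (0 < b)%R -> (a + b = 1)%R ->
  BL l s0 -> BL l s1 -> BL l (fun j => s0 j * a + s1 j * b)%R.
Proof.
move=> s00 s10 a0 b0 ab1 BL0 BL1 r.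
have [C0 C00 hC0] := BL0 r; have [C1 C10 hC1] := BL1 r.
exists (powR C0 a * powR C1 b)%R; first by rewrite mulr_ge0// powR_ge0.
move=> F mF F0.
have prodD (x : J -> \bar R) : (forall j, 0 <= x j) ->
    \prod_j x j `^ (s0 j * a + s1 j * b) =
    (\prod_j x j `^ s0 j) `^ a * (\prod_j x j `^ s1 j) `^ b.
  move=> x0; rewrite !prod_poweR; try by move=> j; exact: poweR_ge0.
  rewrite -big_split/=; apply: eq_bigr => j _.
  have sa : (0 <= s0 j * a)%R by rewrite mulr_ge0// ltW.
  have sb : (0 <= s1 j * b)%R by rewrite mulr_ge0// ltW.
  by rewrite ge0_poweRD// !poweRrM.
under eq_integral do rewrite prodD//.
rewrite prodD; last by move=> j; exact: integral_ge0.
apply: (le_trans (integral_poweR_hoelder _ _ _ _ _ _ a0 b0 ab1)).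
- exact: measurable_vbox.
- exact: measurable_BL_integrand.
- exact: measurable_BL_integrand.
- by move=> y; apply: prode_ge0 => j _; exact: poweR_ge0.
- by move=> y; apply: prode_ge0 => j _; exact: poweR_ge0.
have le_poweR (x y : \bar R) t : (0 <= t)%R -> 0 <= x -> x <= y -> x `^ t <= y `^ t.
  move=> t0 x0 xy; apply: gt0_ler_poweR => //; rewrite in_itv/= leey andbT//.
  exact: le_trans xy.
rewrite EFinM muleACA; apply: lee_pmul; try exact: poweR_ge0.
- rewrite -poweR_EFin -poweRM ?lee_fin//.
    apply: le_poweR; [exact: ltW| |exact: hC0].
    by apply: integral_ge0 => y _; apply: prode_ge0 => j _; exact: poweR_ge0.
  by apply: prode_ge0 => j _; exact: poweR_ge0.
- rewrite -poweR_EFin -poweRM ?lee_fin//.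
    apply: le_poweR; [exact: ltW| |exact: hC1].
    by apply: integral_ge0 => y _; apply: prode_ge0 => j _; exact: poweR_ge0.
  by apply: prode_ge0 => j _; exact: poweR_ge0.
Qed.

Lemma leb_integral_translate (H : vectType R) (a : H) (f : vec H -> \bar R) :
  measurable_fun setT f -> (forall y, 0 <= f y) ->
  \int[leb H]_y f ((y : H) + a)%R = \int[leb H]_y f y.
Proof.
move=> mf f0.
have mg : measurable_fun [set: vec H] (fun y => (y : H) + a : vec H)%R.
  exact: (@measurable_vec_add _ H _ (vec H) idfun (cst a)
      (@measurable_id _ _ _) (@measurable_cst _ _ _ _ _ _)).
pose nu : {measure set (vec H) -> \bar R} :=
  measure_function_pushforward__canonical__measure_function_Measure (leb H) mg.
rewrite [RHS](eq_measure_integral nu); last first.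
  by move=> A mA _; exact/esym/leb_translate.
by rewrite [RHS]ge0_integral_pushforward// preimage_setT.
Qed.

End BrascampLieb.

Section BrascampLiebSteps.
Context {R : realType} {J : finType}.
Local Open Scope ereal_scope.

Lemma vbox_lfun (H H' : vectType R) (T : 'Hom(H, H')) :
  exists2 K : R, (0 <= K)%R &
    forall r y, box (vbasis {:H}) r y -> box (vbasis {:H'}) (K * r)%R (T y).
Proof. by apply: box_lfun; exact: vbasisP. Qed.

Lemma measurable_glue (H : vectType R) (V : {vspace H}) :
  measurable_fun setT (fun z : vec (subvs_of V) * vec (subvs_of V^C%VS) =>
    incl V z.1 + incl V^C z.2 : vec H)%R.
Proof.
apply: measurable_vec_add.
  exact: measurableT_comp (measurable_vec_lfun (incl V)) measurable_fst.
exact: measurableT_comp (measurable_vec_lfun (incl V^C)) measurable_snd.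
Qed.

Section Split.
Context (H : vectType R) (Hj : J -> vectType R) (l : forall j, 'Hom(H, Hj j)).
Variable V : {vspace H}.

Definition lsub j : 'Hom(subvs_of V, subvs_of (l j @: V)%VS) :=
  (proj (l j @: V) \o l j \o incl V)%VF.

(** The map induced by [l j] from H/V to H_j/l_j(V), with complements as models of the quotients. *)
Definition lquo j : 'Hom(subvs_of V^C, subvs_of (l j @: V)^C%VS) :=
  (projC (l j @: V) \o l j \o incl V^C)%VF.

Lemma incl_lsub j w : incl _ (lsub j w) = l j (incl V w).
Proof. by rewrite !comp_lfunE incl_proj// memv_img// incl_mem. Qed.

Lemma lquoE j u : lquo j u = projC (l j @: V) (l j (incl V^C u)).
Proof. by rewrite /lquo 2!comp_lfunE. Qed.

Lemma incl_lquo j u :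
  (incl _ (proj (l j @: V) (l j (incl V^C u))) + incl _ (lquo j u))%R =
  l j (incl V^C u).
Proof. by rewrite lquoE split_proj. Qed.

(** For a fixed component [u] in the complement, [F j] is seen along a translate of [l j @: V]. The
    inequality for [lsub] bounds the integral along [V] by the fibre integrals [G j] at [lquo j u].
    The inequality for [lquo], with the same exponents, applies to the [G j], whose integrals are
    those of the [F j] up to the factors [cj j]. *)
Lemma BL_split (s : J -> R) : (forall j, 0 <= s j)%R ->
  BL lsub s -> BL lquo s -> BL l s.
Proof.
move=> s0 BLsub BLquo r.
have [K1 _ hK1] := vbox_lfun (proj V).
have [K2 _ hK2] := vbox_lfun (projC V).
have [C1 C10 hC1] := BLsub (K1 * r)%R.
have [C2 C20 hC2] := BLquo (K2 * r)%R.
have [c c0 hc] := leb_split V.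
have /choice[cj hcj] : forall j, exists c : R, (0 < c)%R /\
    forall f : vec (Hj j) -> \bar R, measurable_fun setT f -> (forall y, 0 <= f y) ->
    \int[leb (Hj j)]_y f y = c%:E * \int[leb (subvs_of (l j @: V)^C%VS)]_u
      \int[leb (subvs_of (l j @: V))]_w f (incl _ w + incl _ u)%R.
  by move=> j; have [d d0 hd] := leb_split (l j @: V)%VS; exists d.
pose k : R := (\prod_j powR (cj j)^-1 (s j))%R.
have k0 : (0 <= k)%R by apply: prodr_ge0 => j _; exact: powR_ge0.
exists (c * (C1 * C2 * k))%R.
  exact: mulr_ge0 (ltW c0) (mulr_ge0 (mulr_ge0 C10 C20) k0).
move=> F mF F0.
set Bx := box (vbasis {:H}) r.
set B1 := box (vbasis {:subvs_of V}) (K1 * r).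
set B2 := box (vbasis {:subvs_of V^C}) (K2 * r).
pose f (y : vec H) := \prod_j F j (l j y) `^ s j.
have mf : measurable_fun setT f by exact: measurable_BL_integrand.
have f0 y : 0 <= f y by apply: prode_ge0 => j _; exact: poweR_ge0.
have mBx : measurable Bx by exact: measurable_vbox.
have mB1 : measurable B1 by exact: measurable_vbox.
have mB2 : measurable B2 by exact: measurable_vbox.
have mf_box : measurable_fun setT (f \_ Bx).
  exact: (measurable_restrictT _ mBx).1 (measurable_funTS mf).
have fBx0 y : 0 <= (f \_ Bx) y by exact: erestrict_ge0.
rewrite integral_mkcond hc//.
rewrite EFinM -muleA; apply: lee_wpmul2l; first by rewrite lee_fin ltW.
pose G j (z : vec (subvs_of (l j @: V)^C%VS)) :=
  \int[leb (subvs_of (l j @: V))]_x F j (incl _ x + incl _ z)%R.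
have mFglue j : measurable_fun setT
    (fun z : vec (subvs_of (l j @: V)) * vec (subvs_of (l j @: V)^C%VS) =>
      F j (incl _ z.1 + incl _ z.2)%R).
  exact: measurableT_comp (mF j) (@measurable_glue _ (l j @: V)%VS).
have mG j : measurable_fun setT (G j).
  exact: (measurable_fun_fubini_tonelli_G (m1 := leb (subvs_of (l j @: V))) _ (mFglue j)).
have G0 j z : 0 <= G j z by exact: integral_ge0.
have GE j : \int[leb (subvs_of (l j @: V)^C%VS)]_z G j z =
    (cj j)^-1%:E * \int[leb (Hj j)]_z F j z.
  have [cj0 hcjE] := hcj j.
  by rewrite hcjE// muleA -EFinM mulVf ?gt_eqF// mul1e.
pose h (u : vec (subvs_of V^C)) := \prod_j G j (lquo j u) `^ s j.
have mh : measurable_fun setT h by exact: measurable_BL_integrand.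
have h0 u : 0 <= h u by apply: prode_ge0 => j _; exact: poweR_ge0.
(* The part of [l j (incl V^C u)] inside [l j @: V] enters only as the shift [a j], which
   translation invariance removes from the integral. *)
have inner u : \int[leb (subvs_of V)]_(w in B1) f (incl V w + incl V^C u)%R <= C1%:E * h u.
  pose a j := proj (l j @: V) (l j (incl V^C u)).
  pose F' j (x : vec (subvs_of (l j @: V))) :=
    F j (incl _ ((x : subvs_of _) + a j) + incl _ (lquo j u))%R.
  have mF' j : measurable_fun setT (F' j).
    apply: measurableT_comp (mF j) _; apply: measurable_vec_add; last exact: measurable_cst.
    apply: measurableT_comp (measurable_vec_lfun (incl _)) _.
    by apply: measurable_vec_add; [exact: measurable_id|exact: measurable_cst].
  have F'0 j z : 0 <= F' j z by exact: F0.
  have := hC1 F' mF' F'0.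
  rewrite (eq_integral (fun w : vec (subvs_of V) => f (incl V w + incl V^C u)%R)); last first.
    move=> w _; apply: eq_bigr => j _; congr (F j _ `^ _).
    rewrite [l j _]linearD/= -[l j (incl V^C u)]incl_lquo -incl_lsub.
    by rewrite [incl _ (_ + _)%R]linearD/= addrA.
  move=> /le_trans; apply; rewrite /h (eq_bigr (fun j => G j (lquo j u) `^ s j))// => j _.
  congr (_ `^ _); rewrite /G.
  pose F'' (x : vec (subvs_of (l j @: V))) := F j (incl _ x + incl _ (lquo j u))%R.
  apply: (leb_integral_translate (a j) (f := F'')) => [|y]; last exact: F0.
  apply: measurableT_comp (mF j) _; apply: measurable_vec_add; last exact: measurable_cst.
  exact: measurable_vec_lfun.
pose g (z : vec (subvs_of V) * vec (subvs_of V^C)%VS) :=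
  (f \_ Bx) (incl V z.1 + incl V^C z.2)%R.
have mg : measurable_fun setT g.
  exact: measurableT_comp mf_box (@measurable_glue _ V).
have mgG : measurable_fun setT (fubini_G (leb (subvs_of V)) g).
  by apply: measurable_fun_fubini_tonelli_G => // z; exact: fBx0.
(* The components of a point of [Bx] lie in [B1] and [B2], so the integral over [Bx] is at most the
   iterated integral over these two boxes. *)
apply: (@le_trans _ _ (\int[leb (subvs_of V^C)]_(u in B2) (C1%:E * h u))).
  rewrite [leRHS]integral_mkcond; apply: ge0_le_integral => //.
  - by move=> u _; apply: integral_ge0 => w _; exact: fBx0.
  - apply: (measurable_restrictT _ mB2).1; apply: measurable_funTS.
    exact: measurable_funeM.
  move=> u _; rewrite patchE; case: ifPn => [uB2|uB2].
    apply: le_trans (inner u); rewrite [leRHS]integral_mkcond.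
    apply: ge0_le_integral => //.
    + apply: measurableT_comp mf_box _; apply: measurable_vec_add; last exact: measurable_cst.
      exact: measurable_vec_lfun.
    + apply: (measurable_restrictT _ mB1).1; apply: measurable_funTS.
      apply: measurableT_comp mf _; apply: measurable_vec_add; last exact: measurable_cst.
      exact: measurable_vec_lfun.
    move=> w _; rewrite !patchE; case: ifPn => [/set_mem wBx|_]; last by case: ifP.
    by rewrite mem_set// -(proj_split w u); exact: hK1.
  rewrite integral0_eq// => w _; rewrite patchE; case: ifPn => // /set_mem wBx.
  by case/negP: uB2; rewrite mem_set// -(projC_split w u); exact: hK2.
rewrite ge0_integralZl//; last exact: measurable_funTS.
rewrite -mulrA EFinM -muleA; apply: lee_wpmul2l => //.
apply: (le_trans (hC2 G mG G0)); rewrite EFinM -muleA; apply: lee_wpmul2l => //.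
rewrite /k -prodEFin -big_split/=.
rewrite (eq_bigr (fun j =>
  (powR (cj j)^-1 (s j))%:E * (\int[leb (Hj j)]_z F j z) `^ s j))// => j _.
have [cj0 _] := hcj j.
by rewrite GE poweRM ?poweR_EFin// ?integral_ge0// lee_fin invr_ge0 ltW.
Qed.

End Split.

Section Base.
Context (H : vectType R) (Hj : J -> vectType R) (l : forall j, 'Hom(H, Hj j)).

Lemma dim0_eq0 (W : vectType R) (z : W) : \dim {:W} = 0%N -> z = 0%R.
Proof.
move=> /eqP; rewrite dimv_eq0 => /eqP W0.
by apply/eqP; rewrite -memv0 -W0 memvf.
Qed.

Lemma leb_dim0 (W : vectType R) : \dim {:W} = 0%N -> leb W setT = 1.
Proof.
move=> W0; rewrite -(_ : box (vbasis {:W}) 1 = setT) ?leb_box ?ler01//.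
  by rewrite W0 expr0.
by apply/seteqP; split=> // z _ i; have := ltn_ord i; rewrite [X in (_ < X)%N]W0.
Qed.

Lemma leb_box_lty (W : vectType R) r : leb W (box (vbasis {:W}) r) < +oo.
Proof.
apply: (@le_lt_trans _ _ (leb W (box (vbasis {:W}) `|r|%R))); last by rewrite leb_box// ltry.
apply: le_measure; rewrite ?inE; [exact: measurable_vbox..|].
by move=> y yr i; rewrite (le_trans (yr i))// ler_norm.
Qed.

(** With exponent 0 both sides are 1. A space of dimension 0 is one point, of mass 1, so that
    integrating is evaluating. *)
Lemma inactive_factor (W : vectType R) (t : R) (F : vec W -> \bar R) (z : W) :
  measurable_fun setT F -> (forall z, 0 <= F z) ->
  t = 0%R \/ \dim {:W} = 0%N -> F z `^ t = (\int[leb W]_z F z) `^ t.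
Proof.
move=> mF F0 [->|W0]; first by rewrite !poweRe0.
rewrite (eq_integral (cst (F z))); last first.
  by move=> w _; rewrite (dim0_eq0 (w : W) W0) (dim0_eq0 z W0).
by rewrite integral_cst// -[X in _ * X]/(leb W setT) leb_dim0// mule1.
Qed.

Lemma BL_inactive (s : J -> R) :
  (forall j, s j = 0%R \/ \dim {:Hj j} = 0%N) -> BL l s.
Proof.
move=> sin r; have lbox := leb_box_lty H r.
exists (fine (leb H (box (vbasis {:H}) r))); first exact: fine_ge0.
move=> F mF F0; rewrite fineK ?ge0_fin_numE//.
rewrite (eq_integral (cst (\prod_j (\int[leb (Hj j)]_z F j z) `^ s j))).
  rewrite integral_cst; last exact: measurable_vbox.
  by rewrite muleC lexx.
by move=> y _; apply: eq_bigr => j _; exact: inactive_factor.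
Qed.

(** All factors but the one at [j0] are constant. The remaining one is integrated over all of [H]
    and transported by [l j0], at the cost of the factor [c^-1]. *)
Lemma BL_bijective (s : J -> R) (j0 : J) :
  (forall j, j != j0 -> s j = 0%R \/ \dim {:Hj j} = 0%N) -> s j0 = 1%R ->
  lker (l j0) = 0%VS -> limg (l j0) = fullv -> BL l s.
Proof.
move=> sin sj0 ker0 img r; have [c c0 hc] := leb_bijective ker0 img.
exists c^-1%R; first by rewrite invr_ge0 ltW.
move=> F mF F0.
pose K := \prod_(j | j != j0) (\int[leb (Hj j)]_z F j z) `^ s j.
have K0 : 0 <= K by apply: prode_ge0 => j _; exact: poweR_ge0.
have mFl : measurable_fun setT (fun y : vec H => F j0 (l j0 y)).
  exact: measurableT_comp (mF j0) (measurable_vec_lfun (l j0)).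
have FE (y : H) : \prod_j F j (l j y) `^ s j = K * F j0 (l j0 y).
  rewrite (bigD1 j0)//= sj0 poweRe1// muleC; congr (_ * _).
  by apply: eq_bigr => j jj0; exact/inactive_factor/sin.
rewrite (eq_integral (fun y : vec H => K * F j0 (l j0 y))); last by move=> y _; exact: FE.
apply: (@le_trans _ _ (\int[leb H]_y (K * F j0 (l j0 y)))).
  apply: ge0_subset_integral => //; [exact: measurable_vbox| |].
    exact: emeasurable_funM.
  by move=> y _; rewrite mule_ge0.
rewrite ge0_integralZl// (bigD1 j0)//= sj0 poweRe1 ?integral_ge0// hc//.
by rewrite !muleA -EFinM mulVf ?gt_eqF// mul1e -/K muleC.
Qed.

End Base.

End BrascampLiebSteps.

(** * Sufficiency of the codimension conditions *)

Section Feasibility.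
Context {R : realType} {J : finType}.

(* With [V] the full space, the conditions force [l j] to be surjective whenever
   [0 < s j]; with [V = lker (l j)], they then give [s j <= 1] when the target is
   nonzero.  This is why neither is required. *)
Definition feasible (H : vectType R) (Hj : J -> vectType R)
    (l : forall j, 'Hom(H, Hj j)) (s : J -> R) : Prop :=
  (forall j, 0 <= s j) /\
  forall V : {vspace H}, \sum_j s j * (codim (l j @: V))%:R <= (codim V)%:R.

Definition critical (H : vectType R) (Hj : J -> vectType R)
    (l : forall j, 'Hom(H, Hj j)) (s : J -> R) (V : {vspace H}) : Prop :=
  \sum_j s j * (codim (l j @: V))%:R = (codim V)%:R.

Lemma codimE (W : vectType R) (V : {vspace W}) :
  (codim V)%:R = (\dim {:W})%:R - (\dim V)%:R :> R.
Proof. by rewrite /codim natrB// dimvS// subvf. Qed.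

Lemma dim_limg_inj (W W' : vectType R) (f : 'Hom(W, W')) (U : {vspace W}) :
  lker f = 0%VS -> \dim (f @: U) = \dim U.
Proof. by move=> f0; apply: limg_dim_eq; rewrite f0 capv0. Qed.

Lemma dim_subvs (W : vectType R) (V : {vspace W}) : \dim {:subvs_of V} = \dim V.
Proof. by rewrite -[in RHS](limg_incl V) dim_limg_inj// lker_incl. Qed.

Lemma codim_incl (W : vectType R) (V0 : {vspace W}) (U : {vspace subvs_of V0}) :
  (codim (incl V0 @: U))%:R = (codim V0)%:R + (codim U)%:R :> R.
Proof. by rewrite !codimE dim_limg_inj ?lker_incl// dim_subvs; lra. Qed.

Lemma dim_add_incl (W : vectType R) (V0 : {vspace W}) (U : {vspace subvs_of V0^C}) :
  \dim (V0 + incl V0^C @: U) = (\dim V0 + \dim U)%N.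
Proof.
rewrite dimv_disjoint_sum ?dim_limg_inj ?lker_incl//.
apply/eqP; rewrite -subv0 -(capv_compl V0); apply: capvS => //.
by apply/subvP => y /memv_imgP[u _ ->]; exact: incl_mem.
Qed.

Lemma codim_add_incl (W : vectType R) (V0 : {vspace W}) (U : {vspace subvs_of V0^C}) :
  (codim (V0 + incl V0^C @: U))%:R = (codim U)%:R :> R.
Proof.
rewrite !codimE dim_add_incl dim_subvs dimv_compl natrD natrB; first lra.
by rewrite dimvS// subvf.
Qed.

Section SplitFeasible.
Context (H : vectType R) (Hj : J -> vectType R) (l : forall j, 'Hom(H, Hj j)).
Variables (s : J -> R) (V : {vspace H}).
Hypotheses (s_feas : feasible l s) (V_crit : critical l s V).

(** For [U] inside [V], the codimension of [U] in [H] is that of [V] plus that of [U] in [V], and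
    likewise for the images. The equality at [V] cancels the first terms of the condition at [U]. *)
Lemma feasible_lsub : feasible (lsub l V) s.
Proof.
have [s0 sV] := s_feas; split=> // U.
have := sV (incl V @: U)%VS; rewrite codim_incl -V_crit.
rewrite (eq_bigr (fun j => s j * (codim (l j @: V))%:R +
    s j * (codim (lsub l V j @: U))%:R)).
  by rewrite big_split/= lerD2l.
move=> j _; rewrite -mulrDr; congr (_ * _).
rewrite -codim_incl -!limg_comp; congr (codim (_ @: U)%VS)%:R.
by apply/lfunP => u; rewrite [LHS]comp_lfunE -incl_lsub [RHS]comp_lfunE.
Qed.

(** The condition for [l] is tested on subspaces containing [V]. As [l j] and [lquo j] differ by
    elements of [l j @: V] on the complement, the image of [V + U] is the sum of [l j @: V] and the
    image of [U] under [lquo j]. *)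
Lemma feasible_lquo : feasible (lquo l V) s.
Proof.
have [s0 sV] := s_feas; split=> // U.
have := sV (V + incl V^C @: U)%VS; rewrite codim_add_incl.
rewrite (eq_bigr (fun j => s j * (codim (lquo l V j @: U))%:R))// => j _.
congr (_ * _); rewrite -codim_add_incl limgD; congr (codim _)%:R.
apply/eqP; rewrite eqEsubv !subv_add !addvSl/=; apply/andP; split.
  apply/subvP => y /memv_imgP[_ /memv_imgP[u uU ->] ->].
  rewrite -incl_lquo memv_add ?incl_mem//.
  by apply: memv_img; exact: memv_img.
apply/subvP => y /memv_imgP[_ /memv_imgP[u uU ->] ->].
have -> : incl _ (lquo l V j u) =
    - incl _ (proj (l j @: V) (l j (incl V^C u))) + l j (incl V^C u).
  by rewrite -[X in _ = _ + X]incl_lquo addKr.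
rewrite memv_add ?memvN ?incl_mem//.
by apply: memv_img; exact: memv_img.
Qed.

End SplitFeasible.

(** The ratio test of linear programming: [a] is the slack of a constraint and [b] its rate of
    change, and the first constraint to be exhausted minimizes [a / - b] among those with [b < 0].
    The map [k] reduces a possibly infinite family to finitely many constraints, so the minimum
    exists. *)
Lemma blocking_step (X : Type) (I : finType) (k : X -> I) (a b : I -> R) :
  (forall x, 0 <= a (k x)) -> (forall x, b (k x) < 0 -> 0 < a (k x)) ->
  (exists x, b (k x) < 0) ->
  exists2 t : R, 0 < t & (forall x, 0 <= a (k x) + t * b (k x)) /\
    exists2 x, b (k x) < 0 & a (k x) + t * b (k x) = 0.
Proof.
move=> a0 ab [x0 bx0].
pose P i := `[< exists2 x, k x = i & b i < 0 >].
have Px0 : P (k x0) by apply/asboolP; exists x0.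
pose q i := a i / - b i.
case: (arg_minP q Px0) => i /asboolP[x kx bi] qmin; rewrite -kx in bi qmin.
have qb y : b (k y) < 0 -> a (k y) + q (k y) * b (k y) = 0.
  by move=> by0; rewrite /q invrN mulrN mulNr divfK ?lt_eqF// subrr.
exists (q (k x)); first by rewrite /q divr_gt0 ?oppr_gt0// ab.
split; last by exists x => //; exact: qb.
move=> y; have [by0|by0] := ltP (b (k y)) 0; last first.
  rewrite addr_ge0 ?a0// mulr_ge0// /q divr_ge0 ?a0// oppr_ge0 ltW//.
have qxy : q (k x) <= q (k y) by apply: qmin; apply/asboolP; exists y.
by rewrite -[leLHS](qb y by0) lerD2l ler_wnM2r// ltW.
Qed.

End Feasibility.

(** * Moving the exponents, and the induction *)

Section Induction.
Context {R : realType} {J : finType}.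

Section Direction.
Context (H : vectType R) (Hj : J -> vectType R) (l : forall j, 'Hom(H, Hj j)).

(** All slacks are affine in [t]. By hypothesis those that shrink along [d] are not yet exhausted,
    whence [0 < t], and at least one does shrink, so that some constraint stops the motion. *)
Lemma direction_step (s d : J -> R) :
  feasible l s -> (forall j, d j < 0 -> 0 < s j) ->
  (forall V, 0 < \sum_j d j * (codim (l j @: V))%:R -> ~ critical l s V) ->
  (exists j, d j < 0) \/ (exists V, 0 < \sum_j d j * (codim (l j @: V))%:R) ->
  exists2 t : R, 0 < t & feasible l (fun j => s j + t * d j) /\
    ((exists2 j, d j < 0 & s j + t * d j = 0) \/
     (exists2 V, 0 < \sum_j d j * (codim (l j @: V))%:R &
        critical l (fun j => s j + t * d j) V)).
Proof.
move=> [s0 sV] ds dV dex.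
(* A constraint depends on [V] only through the codimensions of [V] and of its
   images, so finitely many constraints suffice. *)
pose N := (\dim {:H} + \sum_j \dim {:Hj j})%N.
have codim_le (W : vectType R) (V : {vspace W}) : (codim V <= \dim {:W})%N.
  by rewrite /codim leq_subr.
have leHN (V : {vspace H}) : (codim V < N.+1)%N.
  by rewrite ltnS (leq_trans (codim_le _ _))// leq_addr.
have lejN j (V : {vspace Hj j}) : (codim V < N.+1)%N.
  rewrite ltnS (leq_trans (codim_le _ _))// /N (bigD1 j)//= addnCA leq_addr//.
pose code (V : {vspace H}) : 'I_N.+1 * {ffun J -> 'I_N.+1} :=
  (inord (codim V), [ffun j => inord (codim (l j @: V))]).
pose k (x : {vspace H} + J) : ('I_N.+1 * {ffun J -> 'I_N.+1}) + J :=
  match x with inl V => inl (code V) | inr j => inr j end.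
pose a (i : ('I_N.+1 * {ffun J -> 'I_N.+1}) + J) : R :=
  match i with inl c => (c.1 : nat)%:R - \sum_j s j * (c.2 j : nat)%:R | inr j => s j end.
pose b (i : ('I_N.+1 * {ffun J -> 'I_N.+1}) + J) : R :=
  match i with inl c => - \sum_j d j * (c.2 j : nat)%:R | inr j => d j end.
have aV V : a (k (inl V)) = (codim V)%:R - \sum_j s j * (codim (l j @: V))%:R.
  rewrite /= inordK//; congr (_ - _); apply: eq_bigr => j _.
  by rewrite ffunE inordK.
have bV V : b (k (inl V)) = - \sum_j d j * (codim (l j @: V))%:R.
  by rewrite /=; congr (- _); apply: eq_bigr => j _; rewrite ffunE inordK.
have [||| t t0 [tfeas tblock]] := @blocking_step R _ _ k a b.
- by case=> [V|j]; [rewrite aV subr_ge0|exact: s0].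
- case=> [V|j]; last exact: ds.
  rewrite aV bV oppr_lt0 => /dV ncrit; rewrite subr_gt0 lt_neqAle sV andbT.
  exact/eqP.
- case: dex => [[j dj]|[V dVV]]; first by exists (inr j).
  by exists (inl V); rewrite bV oppr_lt0.
have slackE V : a (k (inl V)) + t * b (k (inl V)) =
    (codim V)%:R - \sum_j (s j + t * d j) * (codim (l j @: V))%:R.
  rewrite aV bV mulrN -addrA -opprD; congr (_ - _).
  by rewrite mulr_sumr -big_split/=; apply: eq_bigr => j _; rewrite mulrDl mulrA.
exists t => //; split.
  split=> [j|V]; first exact: tfeas (inr j).
  by rewrite -subr_ge0 -slackE; exact: tfeas.
case: tblock => -[V|j] bx ax; last by left; exists j.
right; exists V; first by rewrite -oppr_lt0 -bV.
by apply/esym/eqP; rewrite -subr_eq0 -slackE ax.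
Qed.

End Direction.

(** The indices that contribute to the inequality and to the conditions. Targets of dimension 0
    occur because [l j @: V] or its complement may be 0. *)
Definition active (Hj : J -> vectType R) (s : J -> R) : {set J} :=
  [set j | (s j != 0) && (\dim {:Hj j} != 0%N)].

Lemma codim_full (W : vectType R) : codim (fullv : {vspace W}) = 0%N.
Proof. by rewrite /codim subnn. Qed.

Lemma codim0 (W : vectType R) : codim (0%VS : {vspace W}) = \dim {:W}.
Proof. by rewrite /codim dimv0 subn0. Qed.

Section Fixed.
Context (H : vectType R) (Hj : J -> vectType R) (l : forall j, 'Hom(H, Hj j)).

(** The condition at the full space bounds a sum of nonnegative terms by 0. *)
Lemma feasible_limg s j : feasible l s -> j \in active Hj s ->
  codim (limg (l j)) = 0%N.
Proof.
move=> [s0 sV]; rewrite inE => /andP[sj _].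
have := sV fullv; rewrite codim_full (bigD1 j)//=.
have rest : 0 <= \sum_(i | i != j) s i * (codim (limg (l i)))%:R.
  by apply: sumr_ge0 => i _; rewrite mulr_ge0.
move=> le0; have : s j * (codim (limg (l j)))%:R <= 0 by lra.
rewrite pmulr_rle0; last by rewrite lt_neqAle eq_sym sj s0.
by rewrite lern0 => /eqP.
Qed.

Lemma sum_active s (c : J -> nat) :
  (forall j, (c j <= \dim {:Hj j})%N) ->
  \sum_j s j * (c j)%:R = \sum_(j in active Hj s) s j * (c j)%:R.
Proof.
move=> cle; rewrite [RHS]big_mkcond/=; apply: eq_bigr => j _.
rewrite inE; have [->|_]/= := eqVneq (s j) 0; first by rewrite mul0r.
have [dj|//] := eqVneq (\dim {:Hj j}) 0%N.
by have := cle j; rewrite dj leqn0 => /eqP ->; rewrite mulr0.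
Qed.

(** Criticality of 0 says that [s j0] times the dimension of the target is the dimension of [H]. The
    condition at [lker (l j0)] then leaves no room for a kernel, so both dimensions agree and
    [s j0 = 1]. *)
Lemma BL_single_active s j0 : feasible l s -> active Hj s = [set j0]%SET ->
  critical l s 0%VS -> BL l s.
Proof.
move=> sfeas act crit0; have [s0 sV] := sfeas.
have j0act : j0 \in active Hj s by rewrite act inE.
have /andP[sj0 dj0] : (s j0 != 0) && (\dim {:Hj j0} != 0%N).
  by move: j0act; rewrite inE.
have img : limg (l j0) = fullv.
  apply/eqP; rewrite eqEdim subvf -subn_eq0.
  by rewrite -[X in X == _]/(codim _) (feasible_limg sfeas j0act).
have sumE V : \sum_j s j * (codim (l j @: V))%:R = s j0 * (codim (l j0 @: V))%:R.
  rewrite (@sum_active s (fun j => codim (l j @: V))); last by move=> j; exact: leq_subr.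
  by rewrite act big_set1.
have sn : s j0 * (\dim {:Hj j0})%:R = (\dim {:H})%:R.
  by have := crit0; rewrite /critical sumE limg0 !codim0.
have ker : lker (l j0) = 0%VS.
  apply/eqP; rewrite -dimv_eq0.
  have := sV (lker (l j0)); rewrite sumE.
  rewrite (_ : (l j0 @: _)%VS = 0%VS) ?codim0 ?sn; last first.
    by apply/eqP; rewrite -lkerE.
  by rewrite codimE lerBrDr -natrD ler_nat -[leqRHS]addn0 leq_add2l leqn0.
have s1 : s j0 = 1.
  have := congr1 (fun U : {vspace Hj j0} => \dim U) img.
  rewrite /= dim_limg_inj// => dE; move: sn; rewrite dE -[RHS]mul1r.
  by apply: mulIf; rewrite pnatr_eq0.
apply: (BL_bijective _ s1 ker img) => j jj0.
have : j \notin active Hj s by rewrite act inE.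
rewrite inE negb_and !negbK => /orP[/eqP ->|/eqP ->]; by [left|right].
Qed.

End Fixed.

Section InductiveStep.
Context (H : vectType R) (Hj : J -> vectType R) (l : forall j, 'Hom(H, Hj j)).
Hypothesis IH_dim : forall (H' : vectType R) (Hj' : J -> vectType R)
  (l' : forall j, 'Hom(H', Hj' j)) (s : J -> R),
  (\dim {:H'} < \dim {:H})%N -> feasible l' s -> BL l' s.

Lemma BL_proper_critical s V : feasible l s -> critical l s V ->
  V != 0%VS -> V != fullv -> BL l s.
Proof.
move=> sfeas Vcrit V0 Vf.
have V_gt0 : (0 < \dim V)%N by rewrite lt0n dimv_eq0.
have V_lt : (\dim V < \dim {:H})%N.
  by rewrite ltnNge; apply: contra Vf => Vle; rewrite eqEdim subvf.
apply: (BL_split (V := V) (proj1 sfeas)); apply: IH_dim.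
- by rewrite dim_subvs.
- exact: feasible_lsub.
- by rewrite dim_subvs dimv_compl -subn_gt0 subKn// ltnW.
- exact: feasible_lquo.
Qed.

(* Decreases when an exponent vanishes or when [0] becomes critical. *)
Definition progress s := (#|active Hj s| + `[< ~ critical l s 0%VS >])%N.

Lemma critical0E s :
  critical l s 0%VS <-> \sum_j s j * (\dim {:Hj j})%:R = (\dim {:H})%:R.
Proof.
rewrite /critical codim0 (eq_bigr (fun j => s j * (\dim {:Hj j})%:R))// => j _.
by rewrite limg0 codim0.
Qed.

Lemma BL_direction s d :
  (forall s', (progress s' < progress s)%N -> feasible l s' -> BL l s') ->
  feasible l s ->
  (forall V, critical l s V -> V = 0%VS \/ V = fullv) ->
  (forall j, d j != 0 -> j \in active Hj s) ->
  (critical l s 0%VS -> \sum_j d j * (\dim {:Hj j})%:R = 0) ->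
  (exists j, d j < 0) \/ 0 < \sum_j d j * (\dim {:Hj j})%:R ->
  exists2 t : R, 0 < t & (forall j, 0 <= s j + t * d j) /\
    BL l (fun j => s j + t * d j).
Proof.
move=> IH sfeas ncrit dact d0 dex; have [s0 sV] := sfeas.
have dfull : \sum_j d j * (codim (limg (l j)))%:R = 0.
  apply: big1 => j _; have [->|dj] := eqVneq (d j) 0; first by rewrite mul0r.
  by rewrite (feasible_limg sfeas (dact j dj)) mulr0.
have d0E : \sum_j d j * (codim (l j @: 0%VS))%:R = \sum_j d j * (\dim {:Hj j})%:R.
  by apply: eq_bigr => j _; rewrite limg0 codim0.
have [||| t t0 [tfeas tblock]] := @direction_step H Hj l s d sfeas.
- move=> j dj; have := dact j; rewrite lt_eqF// inE => /(_ isT)/andP[sj _].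
  by rewrite lt_neqAle eq_sym sj s0.
- move=> V dV Vcrit; have [V0|Vf] := ncrit V Vcrit.
    by move: Vcrit dV; rewrite V0 d0E => /d0 ->; rewrite ltxx.
  by move: dV; rewrite Vf dfull ltxx.
- by case: dex => [?|dV]; [left|right; exists 0%VS; rewrite d0E].
exists t => //; split; first exact: (proj1 tfeas).
set s' := fun j => s j + t * d j in tfeas tblock *.
have sub : active Hj s' \subset active Hj s.
  apply/fintype.subsetP => j; rewrite !inE /s' => /andP[s'j ->]; rewrite andbT.
  have [dj|dj] := eqVneq (d j) 0; first by move: s'j; rewrite dj mulr0 addr0.
  by have := dact j dj; rewrite inE => /andP[].
case: tblock => [[j dj s'j]|[V dV Vcrit]].
  (* An exponent vanishes: [j] leaves the active set, and 0 stays critical if it was, so [progress]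
     drops. *)
  apply: IH => //; rewrite /progress -addSn; apply: leq_add.
    apply: proper_card; apply/properP; split=> //; exists j.
      by apply: dact; rewrite lt_eqF.
    by rewrite inE /s' s'j eqxx.
  case: (pselect (critical l s 0%VS)) => crit0; last first.
    by rewrite [X in (_ <= nat_of_bool X)%N]asboolT// leq_b1.
  rewrite [X in (nat_of_bool X <= _)%N]asboolF//; apply; apply/critical0E.
  rewrite /s' (eq_bigr (fun j => s j * (\dim {:Hj j})%:R + t * (d j * (\dim {:Hj j})%:R))).
    by rewrite big_split/= -mulr_sumr d0// mulr0 addr0; exact/critical0E.
  by move=> i _; rewrite mulrDl mulrA.
(* The new critical [V] is not the full space, where the sum for [d] vanishes. If it is nonzero, it
   splits the problem. If it is 0, then 0 was not critical for [s], and the second term of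
   [progress] drops. *)
have [V0|V0] := eqVneq V 0%VS; last first.
  apply: (BL_proper_critical tfeas Vcrit V0); apply/eqP => Vf.
  by move: dV; rewrite Vf dfull ltxx.
rewrite V0 in Vcrit; apply: IH => //; rewrite /progress -addnS.
apply: leq_add; first exact: subset_leq_card.
rewrite asboolF; last exact.
rewrite asboolT// => /d0; rewrite -d0E -V0 => dV0.
by move: dV; rewrite dV0 ltxx.
Qed.

Lemma BL_inductive_step s : feasible l s -> BL l s.
Proof.
have [k] := ubnP (progress s); elim: k s => // k IHk s sk sfeas.
have IH s' : (progress s' < progress s)%N -> feasible l s' -> BL l s'.
  by move=> s's; apply: IHk; exact: leq_trans s's _.
have [s0 sV] := sfeas.
case: (pselect (exists V, [/\ critical l s V, V != 0%VS & V != fullv])) => [[V []]|nproper].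
  exact: BL_proper_critical.
have ncrit V : critical l s V -> V = 0%VS \/ V = fullv.
  move=> Vcrit; have [|V0] := eqVneq V 0%VS; first by left.
  have [|Vf] := eqVneq V fullv; first by right.
  by exfalso; apply: nproper; exists V.
have [act0|[j0 j0act]] := set_0Vmem (active Hj s).
  apply: BL_inactive => j; have : j \notin active Hj s by rewrite act0 inE.
  by rewrite inE negb_and !negbK => /orP[/eqP ->|/eqP ->]; [left|right].
have dim_gt0 j : j \in active Hj s -> 0 < (\dim {:Hj j})%:R :> R.
  by rewrite inE => /andP[_]; rewrite -lt0n ltr0n.
have [single|many] := pselect (critical l s 0%VS /\ active Hj s = [set j0]%SET).
  by apply: (BL_single_active (j0 := j0)) => //; case: single.
(* Such a [d] can be followed with both signs, and [s] is the convex combination of [s + t1 * d] and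
   [s - t2 * d] with weights [t2 / (t1 + t2)] and [t1 / (t1 + t2)]. *)
suff [d [dact d0 dneg dpos]] : exists d : J -> R,
    [/\ (forall j, d j != 0 -> j \in active Hj s),
        (critical l s 0%VS -> \sum_j d j * (\dim {:Hj j})%:R = 0),
        (exists j, d j < 0) \/ 0 < \sum_j d j * (\dim {:Hj j})%:R &
        (exists j, - d j < 0)].
  have [t1 t10 [st1 BL1]] := BL_direction IH sfeas ncrit dact d0 dneg.
  have [|||t2 t20 [st2 BL2]] := BL_direction (d := fun j => - d j) IH sfeas ncrit.
  - by move=> j; rewrite oppr_eq0; exact: dact.
  - move=> /d0 dE; rewrite (eq_bigr (fun j => - (d j * (\dim {:Hj j})%:R))).
      by rewrite sumrN dE oppr0.
    by move=> j _; rewrite mulNr.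
  - by left.
  have t12 : 0 < t1 + t2 by exact: addr_gt0.
  have -> : s = (fun j => (s j + t1 * d j) * (t2 / (t1 + t2)) +
                        (s j + t2 * - d j) * (t1 / (t1 + t2))).
    by apply/funext => j; field; rewrite gt_eqF.
  apply: BL_interpolate => //; try exact: divr_gt0.
  by field; rewrite gt_eqF.
have sum1 j c : \sum_i (if i == j then c else 0) * (\dim {:Hj i})%:R =
    c * (\dim {:Hj j})%:R :> R.
  rewrite (bigD1 j)//= eqxx big1 ?addr0// => i /negPf ->.
  by rewrite mul0r.
have [crit0|ncrit0] := pselect (critical l s 0%VS); last first.
  exists (fun j => if j == j0 then 1 else 0); split=> //.
  - by move=> j; have [->|_] := eqVneq j j0; rewrite ?eqxx.
  - by right; rewrite sum1 mul1r; exact: dim_gt0.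
  - by exists j0; rewrite eqxx oppr_lt0.
have [j1 j1act j10] : exists2 j, j \in active Hj s & j != j0.
  apply: contrapT => noj; apply: many; split=> //.
  apply/setP => j; rewrite inE; apply/idP/eqP => [jact|->//].
  by apply/eqP/negPn/negP => jj0; apply: noj; exists j.
have inv_gt0 j : j \in active Hj s -> 0 < ((\dim {:Hj j})%:R : R)^-1.
  by move=> jact; rewrite invr_gt0; exact: dim_gt0.
(* Raising [s j0] and lowering [s j1] at rates inverse to the dimensions of their targets keeps 0
   critical. *)
pose d j : R := (if j == j0 then ((\dim {:Hj j0})%:R)^-1 else 0) +
  (if j == j1 then - ((\dim {:Hj j1})%:R)^-1 else 0).
have dsum : \sum_j d j * (\dim {:Hj j})%:R = 0.
  rewrite (eq_bigr (fun j =>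
    (if j == j0 then ((\dim {:Hj j0})%:R)^-1 else 0) * (\dim {:Hj j})%:R +
    (if j == j1 then - ((\dim {:Hj j1})%:R)^-1 else 0) * (\dim {:Hj j})%:R)).
    rewrite big_split/= !sum1 mulNr !mulVf ?subrr// gt_eqF//; exact: dim_gt0.
  by move=> j _; rewrite mulrDl.
exists d; split=> //.
- move=> j; rewrite /d; have [->//|_] := eqVneq j j0.
  by have [->//|_] := eqVneq j j1; rewrite addr0 eqxx.
- left; exists j1; rewrite /d (negPf j10) eqxx add0r oppr_lt0; exact: inv_gt0.
- exists j0; rewrite /d eqxx eq_sym (negPf j10) addr0 oppr_lt0; exact: inv_gt0.
Qed.

End InductiveStep.

Theorem feasible_BL (H : vectType R) (Hj : J -> vectType R)
    (l : forall j, 'Hom(H, Hj j)) (s : J -> R) : feasible l s -> BL l s.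
Proof.
have [n] := ubnP (\dim {:H}); elim: n H Hj l s => // n IHn H Hj l s Hn.
apply: BL_inductive_step => H' Hj' l' s' H'H.
by apply: IHn; exact: leq_trans H'H _.
Qed.

End Induction.

(** * Transfer to orthonormal bases *)

Section Transfer.
Context {R : realType} {H : vectType R}.

Section ChangeOfBasis.
Variables e e' : (\dim {:H}).-tuple H.
Hypotheses (e_basis : basis_of fullv e) (e'_basis : basis_of fullv e').

Lemma measurable_idv : measurable_fun [set: borel e] ((fun y => y) : borel e -> borel e').
Proof.
rewrite (_ : (fun y => y) = (\1%VF : 'End(H)) :> (H -> H)).
  exact: measurable_lfun.
by apply/funext => y; rewrite id_lfunE.
Qed.

Lemma measurable_change_basis d (T : measurableType d) (f : H -> T) :
  measurable_fun setT (f : borel e' -> T) -> measurable_fun setT (f : borel e -> T).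
Proof. by move=> mf; exact: measurableT_comp mf measurable_idv. Qed.

Lemma measurable_set_change_basis (A : set H) :
  measurable (A : set (borel e')) -> measurable (A : set (borel e)).
Proof. by move=> mA; rewrite -[X in measurable X]setTI; exact: measurable_idv. Qed.

End ChangeOfBasis.

Variable e : (\dim {:H}).-tuple H.
Hypothesis e_basis : basis_of fullv e.
Local Open Scope ereal_scope.

Lemma lebesgue_borel_setT_neq0 : lebesgue_borel e setT != 0.
Proof.
apply/eqP => H0.
have : lebesgue_borel e (box e 1) <= lebesgue_borel e setT.
  by apply: le_measure => //; rewrite inE//; exact: measurable_box.
by rewrite H0 lebesgue_box ?ler01// mulr1 lee_fin leNgt exprn_gt0// ltr0n.
Qed.

(** This is [leb_pushforward] for the identity, seen as a map from [H] in the basis [e] to [H] in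
    [vbasis]. *)
Lemma leb_lebesgue_borel : exists2 c : R, (0 < c)%R &
  (forall (D : set H) (f : H -> \bar R), measurable (D : set (borel e)) ->
    measurable_fun setT (f : borel e -> \bar R) -> (forall y, 0 <= f y) ->
    \int[lebesgue_borel e]_(y in (D : set (borel e))) f y =
    c%:E * \int[leb H]_(y in (D : set (vec H))) f y) /\
  forall A : set H, measurable (A : set (borel e)) ->
    lebesgue_borel e A = c%:E * leb H A.
Proof.
have vb := vbasisP (fullv : {vspace H}).
have [||||||c c0 hc] := @leb_pushforward R H _ (borel e) (lebesgue_borel e)
  (fun y => y) (fun y => y).
- exact: sigma_finite_lebesgue_borel.
- exact: measurable_idv.
- exact: measurable_idv.
- by [].
- move=> v A mA; apply: lebesgue_borel_translate => //.
  exact: measurable_set_change_basis mA.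
- exact: lebesgue_borel_setT_neq0.
have inv x : x = c^-1%:E * (c%:E * x).
  by rewrite muleA -EFinM mulVf ?gt_eqF// mul1e.
have main (D : set H) (f : H -> \bar R) : measurable (D : set (borel e)) ->
    measurable_fun setT (f : borel e -> \bar R) -> (forall y, 0 <= f y) ->
    \int[lebesgue_borel e]_(y in (D : set (borel e))) f y =
    c^-1%:E * \int[leb H]_(y in (D : set (vec H))) f y.
  move=> mD mf f0.
  have mD' : measurable (D : set (vec H)) by exact: measurable_set_change_basis mD.
  have mf' : measurable_fun setT (f : vec H -> \bar R) by exact: measurable_change_basis mf.
  rewrite [in RHS]integral_mkcond [in LHS]integral_mkcond hc -?inv//.
    exact: (measurable_restrictT _ mD').1 (measurable_funTS mf').
  exact: erestrict_ge0.
exists c^-1%R; first by rewrite invr_gt0.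
split=> // A mA; have mA' : measurable (A : set (vec H)).
  exact: measurable_set_change_basis mA.
have := main setT (EFin \o \1_A) measurableT.
rewrite !integral_indic// !setIT; apply.
  by apply/measurable_EFinP; exact: measurable_indic.
by move=> y; rewrite lee_fin.
Qed.

End Transfer.

Section OrthonormalBall.
Context {R : realType} {H : vectType R} (dotH : {dot H for idfun}).

Lemma pair_ortho_recE (s : seq H) :
  pair_ortho_rec dotH s = pairwise [rel u v | dotH u v == 0] s.
Proof. by elim: s => //= u s ->; rewrite andbT. Qed.

Variable e : (\dim {:H}).-tuple H.
Hypothesis e_on : orthonormal dotH e.

Lemma dot_orthonormal i j : dotH (tnth e i) (tnth e j) = (i == j)%:R.
Proof.
move: e_on => /andP[/allP e1]; rewrite pair_ortho_recE => /(pairwiseP 0) e0.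
have [->|ij] := eqVneq i j; first by apply/eqP/e1; exact: mem_tnth.
wlog lt_ij : i j ij / (i < j)%N.
  move=> wlg; have := ij; rewrite neq_ltn => /orP[ji|ji].
    exact: wlg.
  rewrite hermC expr0 mul1r /=; apply: wlg => //; by rewrite eq_sym.
rewrite !(tnth_nth 0); apply/eqP.
by apply: e0 => //; rewrite inE size_tuple.
Qed.

Lemma orthonormal_basis : basis_of fullv e.
Proof.
rewrite basisEfree size_tuple leqnn subvf !andbT.
apply/freeP => c c0 i.
have := congr1 (dotH (tnth e i)) c0; rewrite linear0r linear_sumr (bigD1 i)//=.
rewrite linearZr_LR/= -tnth_nth dot_orthonormal eqxx mulr1 big1 ?addr0// => j ji.
by rewrite linearZr_LR/= -tnth_nth dot_orthonormal eq_sym (negPf ji) mulr0.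
Qed.

Lemma dot_coord y : dotH y y = \sum_i coord e i y ^+ 2.
Proof.
have yE := coord_basis orthonormal_basis (memvf y).
have dotl i : dotH (tnth e i) y = coord e i y.
  rewrite [in LHS]yE linear_sumr (bigD1 i)//= linearZr_LR/= -tnth_nth.
  rewrite dot_orthonormal eqxx mulr1 big1 ?addr0// => j ji.
  by rewrite linearZr_LR/= -tnth_nth dot_orthonormal eq_sym (negPf ji) mulr0.
rewrite {1}yE linear_sumlz; apply: eq_bigr => i _.
by rewrite linearZl_LR/= -tnth_nth dotl expr2.
Qed.

Lemma hnorm_le1 y : (hnorm dotH y <= 1) = (\sum_i coord e i y ^+ 2 <= 1).
Proof. by rewrite /hnorm dot_coord -{1}sqrtr1 ler_sqrt. Qed.

Lemma measurable_unit_ball :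
  measurable [set y : borel e | hnorm dotH y <= 1].
Proof.
rewrite (_ : [set y | _] =
    (fun y : borel e => \sum_i coord e i y ^+ 2 : R) @^-1` `]-oo, 1]); last first.
  by apply/seteqP; split=> y; rewrite /preimage /= in_itv/= hnorm_le1.
rewrite -[X in measurable X]setTI.
have mf : measurable_fun [set: borel e] (fun y : borel e => \sum_i coord e i y ^+ 2 : R).
  apply: measurable_sum => i; apply: measurable_funX.
  exact: measurable_coord orthonormal_basis _.
by apply: mf => //; exact: measurable_itv.
Qed.

Lemma unit_ball_sub_box : [set y : borel e | hnorm dotH y <= 1] `<=` box e 1.
Proof.
move=> y /=; rewrite hnorm_le1 => y1 i.
rewrite -(@ler_pXn2r _ 2)// ?nnegrE// real_normK ?num_real// expr1n.
apply: le_trans y1; rewrite (bigD1 i)//= lerDl.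
by apply: sumr_ge0 => j _; exact: sqr_ge0.
Qed.

Lemma box_sub_unit_ball : exists2 r : R, 0 < r &
  box e r `<=` [set y : borel e | hnorm dotH y <= 1].
Proof.
(* In the box of size 1/d the sum of squares is at most dim(H)/d^2. The summand 1 gives [1 <= d],
   hence 1/d^2 <= 1/d, and dim(H)/d <= 1. *)
pose d : R := (\dim {:H})%:R + 1.
have d0 : 0 < d by rewrite ltr_pwDr.
exists d^-1; first by rewrite invr_gt0.
move=> y yr /=; rewrite hnorm_le1.
apply: (@le_trans _ _ (\sum_(i < \dim {:H}) d^-1)).
  apply: ler_sum => i _; rewrite -(@real_normK _ (coord e i y)) ?num_real//.
  apply: (@le_trans _ _ (d^-1 ^+ 2)).
    by rewrite ler_pXn2r// ?nnegrE ?invr_ge0 ?(ltW d0)//; exact: yr.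
  by rewrite expr2 ger_pMl ?invr_gt0// invf_le1// lerDr.
rewrite sumr_const card_ord -mulr_natl ler_pdivrMr// mul1r lerDl//.
Qed.

End OrthonormalBall.

Section Sufficiency.
Context {R : realType} {m : nat} {H : vectType R} (dotH : {dot H for idfun}).
Context {Hj : 'I_m -> vectType R}.
Variables (e : (\dim {:H}).-tuple H) (ej : forall j, (\dim {:Hj j}).-tuple (Hj j)).
Hypothesis e_on : orthonormal dotH e.
Hypothesis ej_basis : forall j, basis_of fullv (ej j).
Variable l : forall j, 'Hom(H, Hj j).
Hypothesis l_surj : forall j, limg (l j) = fullv.
Variable p : 'I_m -> \bar R.
Hypothesis p_ge1 : forall j, (1 <= p j)%E.
Local Open Scope ereal_scope.

(** An instance of the inequality itself, for the single map [T] with exponent 1 and the indicator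
    of [N]; rank-nullity gives the codimension condition. It carries almost-everywhere bounds from
    the targets to [H]. *)
Lemma preimage_null (W : vectType R) (T : 'Hom(H, W)) (r : R) (N : set (vec W)) :
  limg T = fullv -> measurable N -> leb W N = 0 ->
  leb H (box (vbasis {:H}) r `&` (T : vec H -> vec W) @^-1` N) = 0.
Proof.
move=> Tf mN N0.
have mTN : measurable ((T : vec H -> vec W) @^-1` N).
  by rewrite -[X in measurable X]setTI; exact: measurable_vec_lfun.
have [|C C0 /(_ (fun=> EFin \o \1_N))] :=
    @feasible_BL R 'I_1 H (fun=> W) (fun=> T) (fun=> 1%R) _ r.
  split=> [//|V]; rewrite big_ord1 mul1r !codimE.
  have := limg_ker_dim T V; have := limg_ker_dim T fullv.
  rewrite capfv Tf => <- <-; rewrite !natrD.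
  have : ((\dim (V :&: lker T))%:R <= (\dim (lker T))%:R :> R)%R.
    by rewrite ler_nat dimvS// capvSr.
  by lra.
have mN1 : measurable_fun setT (EFin \o \1_N : vec W -> \bar R).
  by apply/measurable_EFinP; exact: measurable_indic.
move=> /(_ (fun=> mN1)).
have N1_ge0 (j : 'I_1) (z : vec W) : 0 <= (EFin \o \1_N) z :> \bar R by rewrite lee_fin.
have -> : \int[leb W]_z (EFin \o \1_N) z = 0.
  by rewrite integral_indic// setIT; exact: N0.
move=> /(_ N1_ge0); rewrite big_ord1 poweRe1// mule0.
rewrite (eq_integral (fun y : vec H => (\1_((T : vec H -> vec W) @^-1` N) y)%:E)); last first.
  by move=> y _; rewrite big_ord1 poweRe1 ?lee_fin//= !indicE.
rewrite integral_indic//; last exact: measurable_vbox.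
by rewrite setIC => le0; apply/eqP; rewrite eq_le le0 measure_ge0.
Qed.

Definition recip j : R := fine (p j)^-1.

Lemma recip_ge0 j : (0 <= recip j)%R.
Proof. by rewrite /recip; apply: fine_ge0; rewrite inve_ge0 (le_trans _ (p_ge1 j)). Qed.

Lemma recipE j : (p j)^-1 = (recip j)%:E.
Proof.
rewrite /recip; have := p_ge1 j; case: (p j) => [q| |]//=; rewrite ?invey//.
by rewrite lee_fin inver => q1; rewrite gt_eqF// (lt_le_trans _ q1).
Qed.

Lemma recip_infty j : p j = +oo -> recip j = 0%R.
Proof. by rewrite /recip => ->. Qed.

Lemma recip_fin j : p j != +oo -> exists2 q : R, (0 < q)%R & p j = q%:E /\ recip j = q^-1%R.
Proof.
move=> pNy; have := recipE j; have := p_ge1 j; case: (p j) pNy => [q| |]// _.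
rewrite lee_fin => q1; have q0 : (0 < q)%R by exact: lt_le_trans q1.
by rewrite inver gt_eqF// => -[sE]; exists q.
Qed.

Lemma lee_prod (J : finType) (x y : J -> \bar R) :
  (forall j, 0 <= x j) -> (forall j, x j <= y j) -> \prod_j x j <= \prod_j y j.
Proof.
move=> x0 xy.
suff : 0 <= \prod_j x j /\ \prod_j x j <= \prod_j y j by case.
elim/big_ind2 : _ => // [x1 x2 y1 y2 [x10 x12] [y10 y12]].
by split; [exact: mule_ge0|exact: lee_pmul].
Qed.

Lemma feasible_bound : feasible l recip ->
  exists C : R, forall f : (forall j, borel (ej j) -> R),
    (forall j, measurable_fun [set: borel (ej j)] (f j)) ->
    (forall j y, (0 <= f j y)%R) ->
    \int[lebesgue_borel e]_(y in [set y : borel e | (hnorm dotH y <= 1)%R])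
       (\prod_(j < m) f j (l j y))%R%:E
    <= C%:E * \prod_(j < m) Lnorm (lebesgue_borel (ej j)) (p j) (EFin \o f j).
Proof.
move=> sfeas; have e_basis := orthonormal_basis e_on.
have [c c0 [hc _]] := leb_lebesgue_borel e_basis.
have /choice[cj hcj] : forall j, exists c : R, (0 < c)%R /\ (
  (forall (D : set (Hj j)) (f : Hj j -> \bar R), measurable (D : set (borel (ej j))) ->
    measurable_fun setT (f : borel (ej j) -> \bar R) -> (forall y, 0 <= f y) ->
    \int[lebesgue_borel (ej j)]_(y in (D : set (borel (ej j)))) f y =
    c%:E * \int[leb (Hj j)]_(y in (D : set (vec (Hj j)))) f y) /\
  forall A : set (Hj j), measurable (A : set (borel (ej j))) ->
    lebesgue_borel (ej j) A = c%:E * leb (Hj j) A).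
  by move=> j; have [d d0 hd] := leb_lebesgue_borel (ej_basis j); exists d.
set B := [set y : borel e | (hnorm dotH y <= 1)%R].
have mB : measurable B := measurable_unit_ball e_on.
have mB' : measurable (B : set (vec H)).
  exact: (measurable_set_change_basis (vbasisP _) e_basis mB).
have [r Br] : exists r, B `<=` box (vbasis {:H}) r.
  have [K K0 hK] := @box_lfun _ _ _ e (vbasis {:H}) e_basis \1%VF.
  exists (K * 1)%R => y /(unit_ball_sub_box e_on) /hK.
  by rewrite id_lfunE.
have [C0 C00 hC0] := feasible_BL sfeas r.
pose k : R := (\prod_j powR (cj j)^-1 (recip j))%R.
have k0 : (0 <= k)%R by apply: prodr_ge0 => j _; exact: powR_ge0.
exists (c * (C0 * k))%R => f mf f0.
(* For infinite [p j], [fine] returns 0 and [F j] is the constant 1; the size of [f j] is then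
   carried by [M j]. *)
pose F j (z : vec (Hj j)) : \bar R := (powR (f j z) (fine (p j)))%:E.
pose M j := if p j == +oo then Lnorm (lebesgue_borel (ej j)) +oo (EFin \o f j) else 1.
have M0 j : 0 <= M j by rewrite /M; case: ifP => // _; exact: Lnorm_ge0.
have mfv j : measurable_fun setT (f j : vec (Hj j) -> R).
  exact: (measurable_change_basis (vbasisP _) (ej_basis j) (mf j)).
have mFe j : measurable_fun setT (F j : borel (ej j) -> \bar R).
  apply/measurable_EFinP; exact: measurableT_comp (measurable_powR _) (mf j).
have mF j : measurable_fun setT (F j).
  exact: (measurable_change_basis (vbasisP _) (ej_basis j) (mFe j)).
have F0 j z : 0 <= F j z by rewrite lee_fin powR_ge0.
pose g (y : H) : \bar R := (\prod_(j < m) f j (l j y))%R%:E.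
have g0 y : 0 <= g y by rewrite lee_fin; apply: prodr_ge0 => j _.
have mgv : measurable_fun setT (g : vec H -> \bar R).
  apply/measurable_EFinP; apply: measurable_prod => j _.
  exact: measurableT_comp (mfv j) (measurable_vec_lfun (l j)).
have mg : measurable_fun setT (g : borel e -> \bar R).
  exact: (measurable_change_basis e_basis (vbasisP _) mgv).
pose h (y : vec H) : \bar R := \prod_j F j (l j y) `^ recip j.
have h0 y : 0 <= h y by apply: prode_ge0 => j _; exact: poweR_ge0.
have mh : measurable_fun setT h by exact: measurable_BL_integrand.
(* For infinite [p j] the essential supremum bounds [f j] off a null set of [Hj j], whose preimage
   is null within the box containing [B] by [preimage_null]. *)
have pointwise j : {ae leb H, forall y : vec H, B y ->
    (f j (l j y))%:E <= M j * F j (l j y) `^ recip j}.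
  have [py|pNy] := eqVneq (p j) +oo; last first.
    apply: nearW => y _; rewrite /M (negPf pNy) mul1e /F poweR_EFin -powRrM.
    have [q q0 [-> ->]] := recip_fin pNy.
    by rewrite /= divff ?gt_eqF// powRr1.
  have : \forall z \ae lebesgue_borel (ej j), (f j z)%:E <= M j.
    rewrite /M py eqxx unlock.
    rewrite lt_neqAle measure_ge0 andbT eq_sym (lebesgue_borel_setT_neq0 (ej_basis j)).
    apply: filterS (ess_sup_ge (lebesgue_borel (ej j)) (abse \o (EFin \o f j))) => z.
    by apply: le_trans; rewrite lee_fin ler_norm.
  move=> [N [mN N0 Nf]].
  have mN' : measurable (N : set (vec (Hj j))).
    exact: (measurable_set_change_basis (vbasisP _) (ej_basis j) mN).
  have N0' : leb (Hj j) N = 0.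
    have [cj0 [_ /(_ N mN)]] := hcj j; rewrite [X in X = _]N0 => /esym/eqP.
    by rewrite mule_eq0 eqe gt_eqF//= => /eqP.
  exists (box (vbasis {:H}) r `&` (l j : vec H -> vec (Hj j)) @^-1` N); split.
  - apply: measurableI; first exact: measurable_vbox.
    by rewrite -[X in measurable X]setTI; exact: measurable_vec_lfun.
  - exact: preimage_null.
  - move=> y /= /not_implyP[By fM]; split; first exact: Br.
    by apply: Nf => /= fM'; apply: fM; rewrite recip_infty// powRr0 mule1.
have ae_le : {ae leb H, forall y : vec H, B y -> g y <= \prod_j M j * h y}.
  have : {ae leb H, forall y : vec H, forall j, B y ->
      (f j (l j y))%:E <= M j * F j (l j y) `^ recip j}.
    by apply: filter_forall; exact: pointwise.
  apply: filterS => y hy By.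
  rewrite /g -prodEFin /h -big_split/=; apply: lee_prod => j; first by rewrite lee_fin.
  exact: hy.
rewrite -/g (hc B g)// EFinM -muleA; apply: lee_wpmul2l; first by rewrite lee_fin ltW.
apply: (@le_trans _ _ (\int[leb H]_(y in (B : set (vec H))) (\prod_j M j * h y))).
  apply: ae_ge0_le_integral => //.
  - exact: measurable_funTS.
  - by move=> y _; apply: mule_ge0; [exact: prode_ge0|exact: h0].
  - by apply: measurable_funTS; exact: measurable_funeM.
rewrite ge0_integralZl//; last first.
  exact: prode_ge0.
  exact: measurable_funTS.
apply: (@le_trans _ _ (\prod_j M j * (C0%:E * \prod_j (\int[leb (Hj j)]_z F j z) `^ recip j))).
  apply: lee_wpmul2l; first exact: prode_ge0.
  apply: le_trans (hC0 F mF F0); apply: ge0_subset_integral => //.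
    exact: measurable_vbox.
  exact: measurable_funTS.
rewrite EFinM -muleA [leLHS]muleCA; apply: lee_wpmul2l; first by rewrite lee_fin.
rewrite /k -prodEFin -!big_split/=.
rewrite (eq_bigr (fun j => (powR (cj j)^-1 (recip j))%:E *
  Lnorm (lebesgue_borel (ej j)) (p j) (EFin \o f j)))// => j _.
have [cj0 [/(_ setT _ measurableT (mFe j) (F0 j)) FE _]] := hcj j.
rewrite (_ : \int[leb (Hj j)]_z F j z =
    (cj j)^-1%:E * \int[lebesgue_borel (ej j)]_z F j z); last first.
  by rewrite FE muleA -EFinM mulVf ?gt_eqF// mul1e.
rewrite poweRM ?poweR_EFin ?integral_ge0 ?lee_fin ?invr_ge0 ?(ltW cj0)//.
rewrite muleCA; congr (_ * _); rewrite /M; have [py|pNy] := eqVneq (p j) +oo.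
  by rewrite recip_infty// poweRe0 mule1 py.
have [q q0 [pq ->]] := recip_fin pNy; rewrite mul1e unlock pq.
congr (_ `^ _); apply: eq_integral => z _.
by rewrite /F pq /= ger0_norm.
Qed.

End Sufficiency.

(** * Necessity of the codimension conditions *)

Section Slab.
Context {R : realType} {H : vectType R} (V : {vspace H}).

(** A truncated neighbourhood of [V], of size [r] along [V] and thickness [r'] across; its product
    form makes its measure explicit. *)
Definition slab (r r' : R) : set (vec H) :=
  [set y | box (vbasis {:subvs_of V}) r (proj V y) /\
           box (vbasis {:subvs_of V^C}) r' (projC V y)].

Lemma measurable_slab r r' : measurable (slab r r').
Proof.
apply: measurableI.
  rewrite -[X in measurable X]setTI.
  by apply: (measurable_vec_lfun (proj V)) => //; exact: measurable_vbox.
rewrite -[X in measurable X]setTI.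
by apply: (measurable_vec_lfun (projC V)) => //; exact: measurable_vbox.
Qed.

Lemma leb_slab : exists2 c : R, 0 < c & forall r r', 0 <= r -> 0 <= r' ->
  leb H (slab r r') = (c * (2 * r) ^+ \dim V * (2 * r') ^+ codim V)%:E.
Proof.
have [c c0 hc] := leb_split V; exists c => // r r' r0 r'0.
pose B1 := box (vbasis {:subvs_of V}) r.
pose B2 := box (vbasis {:subvs_of V^C}) r'.
have mB1 : measurable B1 by exact: measurable_vbox.
have mB2 : measurable B2 by exact: measurable_vbox.
have := hc (EFin \o \1_(slab r r')).
rewrite integral_indic//; last exact: measurable_slab.
rewrite setIT => -> //; last 2 first.
  by apply/measurable_EFinP; apply: measurable_indic; exact: measurable_slab.
  by move=> y; rewrite lee_fin.
rewrite -mulrA EFinM; congr (_ * _)%E.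
rewrite (eq_integral (fun u : vec (subvs_of V^C) =>
    (leb (subvs_of V) B1 * (\1_B2 u)%:E)%E)); last first.
  move=> u _; rewrite -[X in (X * _)%E](_ :
      (\int[leb (subvs_of V)]_w (\1_B1 w)%:E)%E = _); last first.
    by rewrite integral_indic// setIT.
  rewrite muleC -ge0_integralZl//; last first.
    by apply/measurable_EFinP; exact: measurable_indic.
  apply: eq_integral => w _; rewrite /= -EFinM; congr EFin.
  rewrite !indicE -natrM mulnb; congr (nat_of_bool _)%:R.
  apply/idP/andP => [/set_mem[]|[/set_mem uB /set_mem wB]].
    by rewrite proj_split projC_split => ? ?; split; exact/mem_set.
  by apply/mem_set; split; rewrite ?proj_split ?projC_split.
rewrite ge0_integralZl//; last by apply/measurable_EFinP; exact: measurable_indic.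
rewrite integral_indic// setIT EFinM; congr (_ * _)%E.
  by rewrite [LHS]leb_box// dim_subvs.
by rewrite [LHS]leb_box// dim_subvs dimv_compl.
Qed.

End Slab.

Lemma power_comparison (R : realType) (A D q : R) (n : nat) : 0 < A ->
  (forall x, 0 < x -> x <= 1 -> A * x ^+ n <= D * powR x q) -> q <= n%:R.
Proof.
move=> A0 AD; rewrite leNgt; apply/negP => nq.
have D0 : A <= D by have := AD 1 ltr01 (lexx 1); rewrite expr1n powR1 !mulr1.
have Dgt0 : 0 < D by exact: lt_le_trans D0.
pose ep := q - n%:R; have ep0 : 0 < ep by rewrite subr_gt0.
(* The point [x] below satisfies [powR x (q - n%:R) = y], so that [D * powR x q] is only half of
   [A * x ^+ n]. The hypothesis at 1 gave [A <= D], whence [x <= 1]. *)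
pose y := A / (2 * D); have y0 : 0 < y by rewrite divr_gt0// mulr_gt0.
have y1 : y <= 1 by rewrite ler_pdivrMr ?mulr_gt0//; lra.
pose x := powR y ep^-1; have x0 : 0 < x by rewrite powR_gt0.
have x1 : x <= 1.
  by rewrite /x -(powRr0 y); apply: ger_powR; rewrite ?y0 ?y1// invr_ge0 ltW.
have := AD x x0 x1; rewrite (_ : powR x q = y * x ^+ n); last first.
  rewrite -powR_mulrn ?ltW// -(_ : powR x ep = y); last first.
    by rewrite -powRrM mulVf ?gt_eqF// powRr1// ltW.
  by rewrite -powRD ?subrK// (gt_eqF x0) implybT.
rewrite mulrA ler_pM2r ?exprn_gt0// /y.
rewrite (_ : D * (A / (2 * D)) = A / 2); last by field; rewrite gt_eqF.
by move=> ?; lra.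
Qed.

Section Necessity.
Context {R : realType} {m : nat} {H : vectType R} (dotH : {dot H for idfun}).
Context {Hj : 'I_m -> vectType R}.
Variables (e : (\dim {:H}).-tuple H) (ej : forall j, (\dim {:Hj j}).-tuple (Hj j)).
Hypothesis e_on : orthonormal dotH e.
Hypothesis ej_basis : forall j, basis_of fullv (ej j).
Variable l : forall j, 'Hom(H, Hj j).
Variable p : 'I_m -> \bar R.
Hypothesis p_ge1 : forall j, (1 <= p j)%E.

(** For infinite [p j] the right side is 1, as a power with exponent 0, while the norm is 0 if [A]
    is null; hence an inequality. *)
Lemma Lnorm_indic_le d (T : measurableType d) (mu : {measure set T -> \bar R})
    (A : set T) j : measurable A -> (mu A < +oo)%E ->
  (Lnorm mu (p j) (EFin \o \1_A) <= mu A `^ recip p j)%E.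
Proof.
move=> mA Afin; have [py|pNy] := eqVneq (p j) +oo%E.
  rewrite py recip_infty// poweRe0 unlock; case: ifP => // _.
  apply/ess_supP; apply: nearW => x /=; rewrite indicE.
  by case: (x \in A); rewrite ?normr1 ?normr0 lee_fin.
have [q q0 [-> ->]] := recip_fin p_ge1 pNy; rewrite unlock.
rewrite (eq_integral (EFin \o \1_A)); first by rewrite integral_indic// setIT.
move=> x _ /=; rewrite indicE; case: (x \in A); rewrite ?normr1 ?normr0.
  by rewrite powR1.
by rewrite powR0// gt_eqF.
Qed.

Lemma bound_feasible :
  (exists C : R, forall f : (forall j, borel (ej j) -> R),
    (forall j, measurable_fun [set: borel (ej j)] (f j)) ->
    (forall j y, (0 <= f j y)%R) ->
    (\int[lebesgue_borel e]_(y in [set y : borel e | (hnorm dotH y <= 1)%R])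
       (\prod_(j < m) f j (l j y))%R%:E
    <= C%:E * \prod_(j < m) Lnorm (lebesgue_borel (ej j)) (p j) (EFin \o f j))%E) ->
  feasible l (recip p).
Proof.
move=> [C hC]; split=> [j|V]; first exact: recip_ge0.
have e_basis := orthonormal_basis e_on.
have [rho rho0 rho_ball] := box_sub_unit_ball e_on.
have [K1 K10 hK1] := @box_lfun R _ _ (vbasis fullv) e (vbasisP _) (incl V).
have [K2 K20 hK2] := @box_lfun R _ _ (vbasis fullv) e (vbasisP _) (incl V^C).
(* Coordinates in the slab [A x] are at most [K1 * a + K2 * (a * x)], which stays below [rho] for
   [x <= 1]; the summand 1 keeps the denominator positive. *)
pose a := rho / (K1 + K2 + 1).
have K120 : 0 < K1 + K2 + 1 by rewrite ltr_wpDl// addr_ge0.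
have a0 : 0 < a by rewrite divr_gt0.
pose A (x : R) := slab V a (a * x).
have A_ball (x : R) : 0 < x -> x <= 1 -> A x `<=` [set y : H | hnorm dotH y <= 1].
  move=> x0 x1 y [/hK1 yV /hK2 yVC]; apply: rho_ball => i.
  rewrite -(split_proj V y) linearD; apply: (le_trans (ler_normD _ _)).
  apply: (le_trans (lerD (yV i) (yVC i))).
  have -> : rho = (K1 + K2 + 1) * a by rewrite /a mulrCA divff ?mulr1// gt_eqF.
  have axa : a * x <= a by rewrite ger_pMr.
  have := ler_wpM2l K20 axa; rewrite !mulrDl mul1r => K2a.
  by rewrite ler_wpDr ?(ltW a0)// lerD2l.
(* The component of [l j y] transverse to [l j @: V] depends only on the transverse component of
   [y], so its size stays proportional to [x]. Along [l j @: V] both components of [y] contribute,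
   and [x <= 1] bounds their sum independently of [x]. *)
have /choice[Kj hKj] : forall j, exists K : R * R, [/\ 0 <= K.1, 0 <= K.2 &
    forall x y, 0 < x -> x <= 1 -> A x y ->
      slab (l j @: V) (K.1 * a) (K.2 * (a * x)) (l j y)].
  move=> j.
  have [L1 L10 hL1] := vbox_lfun (lsub l V j).
  have [L2 L20 hL2] := vbox_lfun (proj (l j @: V) \o l j \o incl V^C)%VF.
  have [L3 L30 hL3] := vbox_lfun (lquo l V j).
  exists (L1 + L2, L3); split=> //=; first exact: addr_ge0.
  move=> x y x0 x1 [yV yVC].
  have lyE : l j y = incl _ (lsub l V j (proj V y) +
      proj (l j @: V) (l j (incl V^C (projC V y)))) + incl _ (lquo l V j (projC V y)).
    by rewrite linearD/= -addrA incl_lquo incl_lsub -linearD/= split_proj.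
  split; rewrite lyE ?proj_split ?projC_split; last exact: hL3.
  move=> i; rewrite linearD; apply: (le_trans (ler_normD _ _)).
  rewrite mulrDl; apply: lerD; first exact: hL1.
  apply: (@le_trans _ _ (L2 * (a * x))).
    by have := hL2 _ _ yVC i; rewrite 2!comp_lfunE.
  by rewrite ler_wpM2l// ger_pMr.
have [c c0 [_ hc]] := leb_lebesgue_borel e_basis.
have [b b0 hb] := leb_slab V.
have /choice[E hE] : forall j, exists E : R, 0 <= E /\
    forall x, 0 <= x -> lebesgue_borel (ej j)
      (slab (l j @: V) ((Kj j).1 * a) ((Kj j).2 * (a * x))) =
      (E * x ^+ codim (l j @: V))%:E.
  move=> j; have [cj cj0 [_ hcj]] := leb_lebesgue_borel (ej_basis j).
  have [bj bj0 hbj] := leb_slab (l j @: V); have [k1 k2 _] := hKj j.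
  exists (cj * (bj * (2 * ((Kj j).1 * a)) ^+ \dim (l j @: V) *
    (2 * ((Kj j).2 * a)) ^+ codim (l j @: V))); split.
    have k1a : 0 <= 2 * ((Kj j).1 * a).
      exact: mulr_ge0 (ler0n _ 2) (mulr_ge0 k1 (ltW a0)).
    have k2a : 0 <= 2 * ((Kj j).2 * a).
      exact: mulr_ge0 (ler0n _ 2) (mulr_ge0 k2 (ltW a0)).
    apply: mulr_ge0 (ltW cj0) (mulr_ge0 (mulr_ge0 (ltW bj0) _) _).
      exact: exprn_ge0.
    exact: exprn_ge0.
  move=> x x0; rewrite hcj; last first.
    exact: (measurable_set_change_basis (ej_basis j) (vbasisP _)
      (@measurable_slab _ _ _ _ _)).
  rewrite (hbj _ _ (mulr_ge0 k1 (ltW a0)) (mulr_ge0 k2 (mulr_ge0 (ltW a0) x0))).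
  rewrite -EFinM; congr EFin.
  have -> : 2 * ((Kj j).2 * (a * x)) = 2 * ((Kj j).2 * a) * x by rewrite !mulrA.
  by rewrite [(_ * x) ^+ _]exprMn -!mulrA.
pose N x j : set (borel (ej j)) := slab (l j @: V) ((Kj j).1 * a) ((Kj j).2 * (a * x)).
have mN x j : measurable (N x j).
  exact: (measurable_set_change_basis (ej_basis j) (vbasisP _)
      (@measurable_slab _ _ _ _ _)).
have mA x : measurable (A x : set (borel e)).
  exact: (measurable_set_change_basis e_basis (vbasisP _)
      (@measurable_slab _ _ _ _ _)).
(* The slab around [V] contributes the exponent [codim V], and the norms of the indicators multiply
   to a power of [x] whose exponent is the sum in the condition at [V]. The absolute value is there
   because [C] is an arbitrary real. *)
apply: (@power_comparison _ (c * (b * (2 * a) ^+ \dim V * (2 * a) ^+ codim V))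
  (`|C| * \prod_j powR (E j) (recip p j))).
  have a2 : 0 < 2 * a by exact: mulr_gt0 (ltr0n _ 2) a0.
  exact: mulr_gt0 c0 (mulr_gt0 (mulr_gt0 b0 (exprn_gt0 _ a2)) (exprn_gt0 _ a2)).
move=> x x0 x1; rewrite -lee_fin.
have mf j : measurable_fun [set: borel (ej j)] (\1_(N x j) : borel (ej j) -> R).
  apply: measurable_indic; exact: mN.
have := hC (fun j => \1_(N x j)) mf (fun j z => ltac:(by [])).
move=> bound; apply: (@le_trans _ _ (lebesgue_borel e (A x))).
  rewrite hc; last exact: mA.
  rewrite (hb _ _ (ltW a0) (mulr_ge0 (ltW a0) (ltW x0))) -EFinM lee_fin.
  by rewrite [2 * (a * x)]mulrA [(2 * a * x) ^+ _]exprMn !mulrA.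
apply: (@le_trans _ _ (\int[lebesgue_borel e]_(y in [set y : borel e | (hnorm dotH y <= 1)%R])
    (\1_(A x) y)%:E)%E).
  rewrite integral_indic//; last exact: measurable_unit_ball.
  by rewrite setIidl//; exact: A_ball.
apply: le_trans (le_trans bound _).
  apply: ge0_le_integral => //.
  - exact: measurable_unit_ball.
  - apply/measurable_EFinP; apply: measurable_funTS.
    by apply: measurable_indic; exact: mA.
  - apply: measurable_funTS; apply/measurable_EFinP; apply: measurable_prod => j _.
    have mlj : measurable_fun setT (l j : borel e -> borel (ej j)) by exact: measurable_lfun.
    exact: measurableT_comp (mf j) mlj.
  move=> y _; rewrite lee_fin indicE; case: (boolP (y \in A x)) => [/set_mem Axy|_].
    rewrite big1// => j _; rewrite indicE mem_set//.
    by have [_ _ h] := hKj j; exact: h.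
  by rewrite prodr_ge0.
apply: (@le_trans _ _ (`|C|%:E * \prod_(j < m)
    (powR (E j) (recip p j) * powR x (recip p j * (codim (l j @: V))%:R))%:E)%E).
  apply: (@le_trans _ _ (`|C|%:E * \prod_(j < m)
      Lnorm (lebesgue_borel (ej j)) (p j) (EFin \o \1_(N x j)))%E).
    apply: lee_wpmul2r; last by rewrite lee_fin ler_norm.
    by apply: prode_ge0 => j _; exact: Lnorm_ge0.
  apply: lee_wpmul2l; first by rewrite lee_fin.
  apply: lee_prod => j; first exact: Lnorm_ge0.
  have [Ej0 hEj] := hE j; have NE := hEj x (ltW x0).
  apply: (le_trans (Lnorm_indic_le _ _ _)); [exact: mN|by rewrite [X in (X < _)%E]NE ltry|].
  rewrite [X in (X `^ _)%E]NE poweR_EFin lee_fin powRM ?exprn_ge0 ?(ltW x0)//.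
  by rewrite -powR_mulrn ?(ltW x0)// -powRrM mulrC [(_ * recip p j)%R]mulrC [leLHS]mulrC.
rewrite prodEFin -EFinM lee_fin big_split/= mulrA ler_wpM2l//.
  by rewrite mulr_ge0// prodr_ge0// => j _; exact: powR_ge0.
rewrite le_eqVlt; apply/orP; left; apply/eqP.
elim/big_ind2 : _ => [|u1 u2 v1 v2 -> ->|j _]; rewrite ?powRr0//.
by rewrite powRD// (gt_eqF x0) implybT.
Qed.

End Necessity.

Lemma feasible_recipP (R : realType) (m : nat) (H : vectType R)
    (Hj : 'I_m -> vectType R) (l : forall j, 'Hom(H, Hj j)) (p : 'I_m -> \bar R) :
  (forall j, (1 <= p j)%E) ->
  feasible l (recip p) <-> forall V : {vspace H},
    (\sum_(j < m) (p j)^-1 * (codim (l j @: V)%VS)%:R%:E <= (codim V)%:R%:E)%E.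
Proof.
move=> p_ge1.
have sumE (V : {vspace H}) : (\sum_(j < m) (p j)^-1 * (codim (l j @: V)%VS)%:R%:E =
    (\sum_(j < m) recip p j * (codim (l j @: V)%VS)%:R)%:E)%E.
  by rewrite -sumEFin; apply: eq_bigr => j _; rewrite recipE// EFinM.
split=> [[_ feas] V|feas]; first by rewrite sumE lee_fin.
split=> [j|V]; first exact: recip_ge0.
by rewrite -lee_fin -sumE.
Qed.

Theorem theorem2p2 (R : realType) (m : nat) (m_ge1 : (1 <= m)%N)
    (H : vectType R) (dotH : {dot H for idfun})
    (Hj : 'I_m -> vectType R) (dotHj : forall j, {dot Hj j for idfun})
    (dimH_gt0 : (0 < \dim {:H})%N)
    (dimHj_gt0 : forall j, (0 < \dim {:Hj j})%N)
    (e : (\dim {:H}).-tuple H) (e_orthonormal : orthonormal dotH e)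
    (ej : forall j, (\dim {:Hj j}).-tuple (Hj j))
    (ej_orthonormal : forall j, orthonormal (dotHj j) (ej j))
    (l : forall j, 'Hom(H, Hj j)) (l_surj : forall j, limg (l j) = fullv)
    (p : 'I_m -> \bar R) (p_ge1 : forall j, (1 <= p j)%E) :
  (exists C : R, forall f : (forall j, borel (ej j) -> R),
      (forall j, measurable_fun [set: borel (ej j)] (f j)) ->
      (forall j y, 0 <= f j y) ->
      (\int[lebesgue_borel e]_(y in [set y : borel e | (hnorm dotH y <= 1)%R])
           (\prod_(j < m) f j (l j y))%R%:E
       <= C%:E * \prod_(j < m) Lnorm (lebesgue_borel (ej j)) (p j) (EFin \o f j))%E)
  <->
  (forall V : {vspace H},
      (\sum_(j < m) (p j)^-1 * (codim (l j @: V)%VS)%:R%:E <= (codim V)%:R%:E)%E).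
Proof.
have ej_basis j : basis_of fullv (ej j) by exact: orthonormal_basis (ej_orthonormal j).
rewrite -feasible_recipP//; split; first exact: bound_feasible.
exact: feasible_bound.
Qed.
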